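(* Let $d\ge2$ be a nonsquare integer with fundamental solution $(X_1,Y_1)$ of $x^2-dy^2=1$. Let $K>X_1$ be an integer and let $w$ be an integer with $w\ge d$ and $2^w\ge d^2K^4$. Then Program QO (defined in the context), on input $d,K,w$, returns $(X_1,Y_1)$. Its packed integer $M$ has at most $2wK^3$ binary digits. The intermediates outside the Hamming-weight subroutine have $O(wK^3+wdK^2)$ binary digits, and hence $O(wK^3)$ when $K\ge d$.
   Context: The fundamental solution is the solution of $x^2-dy^2=1$ in positive integers with $X_1$ least. All values are in $\mathbb N=\{0,1,2,\dots\}$; $u\mathbin{\dot{-}}v=\max(u-v,0)$; $u\bmod v$ is the remainder; divisors are positive. The constants implied by $O(\cdot)$ are absolute. Intermediates are all values computed while evaluating the assignments; those ''outside the Hamming-weight subroutine'' are all except the ones computed inside the call $\mathsf H(M)$ below. Subroutine $\mathsf G_{024}(Q,K,t)$ returns $(G_0,G_2,G_4)$ computed by: $u=Q\mathbin{\dot{-}}1$, $Z_Q=Q^K$, $v=ut$, $Q_+=Q+1$, $u_3=u^3$, $G_0=\lfloor Z_Q/u\rfloor$, $z=v\mathbin{\dot{-}}2$, $g_2=vz+Q_+$, $G_2=\lfloor Z_Qg_2/u_3\rfloor$, $u_5=u^5$, $h=Q_+(Q+9)$, $g_4=g_2g_2+Q\bigl((4v)(z\mathbin{\dot{-}}Q_+)+h\bigr)$, $G_4=\lfloor Z_Qg_4/u_5\rfloor$. A fourth argument, when present, supplies the already computed value $Z_Q=Q^K$. Subroutine $\mathsf H(m)$ (Hamming weight, default form):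 $a=2m$, $L=2^a$, $\alpha=\lfloor(L+1)^a/L^m\rfloor\bmod L$, $e=a$, $\Pi=L$, $\gamma=\alpha\Pi$, $g=\Bigl(\Bigl\lfloor\frac{2^{\gamma(\gamma+\alpha+\Pi)}}{(2^{\gamma\alpha}\mathbin{\dot{-}}1)(2^{\gamma\Pi}\mathbin{\dot{-}}1)}\Bigr\rfloor\bmod2^\gamma\Bigr)\mathbin{\dot{-}}1$, $u=\Pi\mathbin{\dot{-}}1$, output $\lfloor(g^e\bmod u^2)/u\rfloor$. Subroutine $\mathsf C(d,K,A,p,v)$: $h=2K$, $z_c=p+1$, $c_K=\lfloor z_c^h/v\rfloor\bmod p$, $H_c=dh$, $c_{dK}=\lfloor z_c^{H_c}/v^d\rfloor\bmod p$, $a_c=2^{H_c\mathbin{\dot{-}}h}c_K$; it returns $\lfloor Ac_{dK}/a_c\rfloor$. Subroutine $\mathsf R(d,A,B)$: $V_B=d(BB)$, $c=(AA\mathbin{\dot{-}}A)\mathbin{\dot{-}}V_B$, $V_c=cc$, $D_c=V_c\mathbin{\dot{-}}V_B$; it returns the pair $\bigl(\lfloor(V_c+V_B)/D_c\rfloor,\ \lfloor(2B)c/D_c\rfloor\bigr)$. Program QO, with input $d,K,w$ (local variables of subroutines are separate): QO1. $t=K\mathbin{\dot{-}}1$, $P=2^w$, $P_-=P\mathbin{\dot{-}}1$, $q=PP$, $q_1=q^K$, $q_2=q_1^K$, $Q=q_1q_2$. QO2. $(U_0,U_2,U_4)=\mathsf G_{024}(Q,K,t)$, $(V_0,V_2,V_4)=\mathsf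 G_{024}(q,K,t,q_1)$, $d_2=dd$, $D_2=dV_2$, $T_q=P_-\bigl[\bigl(V_0(PU_0\mathbin{\dot{-}}U_4)+2U_2(V_0+D_2)\bigr)\mathbin{\dot{-}}U_0(2D_2+d_2V_4)\bigr]$. QO3. $M=\lfloor T_q/(q_2\mathbin{\dot{-}}1)\rfloor$ (the packed integer), $H_M=\mathsf H(M)$, $\sigma=\lfloor(KK)t/2\rfloor$, $A=\lfloor H_M/w\rfloor\mathbin{\dot{-}}\sigma$. QO4. $B=\mathsf C(d,K,A,q_1,q_2)$; return $\mathsf R(d,A,B)$. *)

(* Defs.v *)
From mathcomp Require Import all_boot.

Set Implicit Arguments.
Unset Strict Implicit.
Unset Printing Implicit Defensive.

(* The truncated subtraction of nat is harmless here: a - b = 1 holds in nat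
   exactly when it holds in the integers. *)
Definition pell_solution (d x y : nat) : Prop :=
  [/\ 0 < x, 0 < y & x ^ 2 - d * y ^ 2 = 1].

Definition fundamental_solution (d x y : nat) : Prop :=
  pell_solution d x y /\ (forall x' y', pell_solution d x' y' -> x <= x').

(* 0 has one binary digit, and n > 0 has floor(log_2 n) + 1 of them. *)
Definition binary_digits (n : nat) : nat := (trunc_log 2 n).+1.

(* An instrumented evaluation: [trace] lists the value of every arithmetic
   operation performed, in order, including those of all subexpressions;
   [result] is [None] when some division or remainder by 0 was attempted. *)
Record comp (A : Type) := Comp { trace : seq nat; result : option A }.

Definition ret A (a : A) : comp A := Comp [::] (Some a).

Definition bind A B (m : comp A) (k : A -> comp B) : comp B :=
  if result m is Some a
  then Comp (trace m ++ trace (k a)) (result (k a))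
  else Comp (trace m) None.

Definition emit (o : option nat) : comp nat :=
  Comp (if o is Some n then [:: n] else [::]) o.

(* Only the value computed by [m] is recorded, not what leads to it. *)
Definition untraced (m : comp nat) : comp nat := emit (result m).

Definition expr := comp nat.

Definition expr_of_nat (n : nat) : expr := ret n.
Coercion expr_of_nat : nat >-> expr.

Definition binop (f : nat -> nat -> option nat) (e1 e2 : expr) : expr :=
  bind e1 (fun x => bind e2 (fun y => emit (f x y))).

Definition e_add : expr -> expr -> expr := binop (fun x y => Some (x + y)).
Definition e_sub : expr -> expr -> expr := binop (fun x y => Some (x - y)).
Definition e_mul : expr -> expr -> expr := binop (fun x y => Some (x * y)).
Definition e_exp : expr -> expr -> expr := binop (fun x y => Some (x ^ y)).
Definition e_div : expr -> expr -> expr :=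
  binop (fun x y => if y == 0 then None else Some (x %/ y)).
Definition e_mod : expr -> expr -> expr :=
  binop (fun x y => if y == 0 then None else Some (x %% y)).

Declare Scope prog_scope.
Delimit Scope prog_scope with prog.
Notation "x + y" := (e_add x y) : prog_scope.
Notation "x - y" := (e_sub x y) : prog_scope.
Notation "x * y" := (e_mul x y) : prog_scope.
Notation "x ^ y" := (e_exp x y) : prog_scope.
Notation "x %/ y" := (e_div x y) : prog_scope.
Notation "x %% y" := (e_mod x y) : prog_scope.
Notation "'let!' x ':=' e 'in' k" := (bind e (fun x => k))
  (at level 200, x binder, k at level 200) : prog_scope.

Local Open Scope prog_scope.

Definition G024 (Q K t : nat) (ZQ : option nat) : comp (nat * nat * nat) :=
  let! u := Q - 1 in
  let! Z := (if ZQ is Some z then ret z else Q ^ K) in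
  let! v := u * t in
  let! Qp := Q + 1 in
  let! u3 := u ^ 3 in
  let! G0 := Z %/ u in
  let! z := v - 2 in
  let! g2 := v * z + Qp in
  let! G2 := (Z * g2) %/ u3 in
  let! u5 := u ^ 5 in
  let! h := Qp * (Q + 9) in
  let! g4 := g2 * g2 + Q * ((4 * v) * (z - Qp) + h) in
  let! G4 := (Z * g4) %/ u5 in
  ret (G0, G2, G4).

Definition hamming (m : nat) : comp nat :=
  let! a := 2 * m in
  let! L := 2 ^ a in
  let! alpha := ((L + 1) ^ a %/ L ^ m) %% L in
  let! e := ret a in
  let! Pi := ret L in
  let! gamma := alpha * Pi in
  let! g := ((2 ^ (gamma * (gamma + alpha + Pi)) %/
              ((2 ^ (gamma * alpha) - 1) * (2 ^ (gamma * Pi) - 1)))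
             %% 2 ^ gamma) - 1 in
  let! u := Pi - 1 in
  (g ^ e %% u ^ 2) %/ u.

Definition ratio_C (d K A p v : nat) : comp nat :=
  let! h := 2 * K in
  let! zc := p + 1 in
  let! cK := (zc ^ h %/ v) %% p in
  let! Hc := d * h in
  let! cdK := (zc ^ Hc %/ v ^ d) %% p in
  let! ac := 2 ^ (Hc - h) * cK in
  (A * cdK) %/ ac.

Definition recover_R (d A B : nat) : comp (nat * nat) :=
  let! VB := d * (B * B) in
  let! c := ((A * A) - A) - VB in
  let! Vc := c * c in
  let! Dc := Vc - VB in
  let! X := (Vc + VB) %/ Dc in
  let! Y := ((2 * B) * c) %/ Dc in
  ret (X, Y).

(* The first component of the result is the packed integer M, the second one
   is the pair returned by the program. *)
Definition QO (d K w : nat) : comp (nat * (nat * nat)) :=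
  let! t := K - 1 in
  let! P := 2 ^ w in
  let! Pm := P - 1 in
  let! q := P * P in
  let! q1 := q ^ K in
  let! q2 := q1 ^ K in
  let! Q := q1 * q2 in
  let! '(U0, U2, U4) := G024 Q K t None in
  let! '(V0, V2, V4) := G024 q K t (Some q1) in
  let! d2 := d * d in
  let! D2 := d * V2 in
  let! Tq := Pm * ((V0 * (P * U0 - U4) + (2 * U2) * (V0 + D2))
                   - U0 * (2 * D2 + d2 * V4)) in
  let! M := Tq %/ (q2 - 1) in
  let! HM := untraced (hamming M) in
  let! sigma := ((K * K) * t) %/ 2 in
  let! A := (HM %/ w) - sigma in
  let! B := ratio_C d K A q1 q2 in
  let! XY := recover_R d A B in
  ret (M, XY).

(* Main.v *)
Require Import Defs.
From mathcomp Require Import all_boot zify.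

Set Implicit Arguments.
Unset Strict Implicit.
Unset Printing Implicit Defensive.

(** The program is a chain of exact counting identities, each read off from the
    digits of one large quotient.

    Packing.  Since q and Q are huge compared with K, the quotients computed by
    the G subroutine are exactly the power sums of the i ^ k * b ^ i over i < K,
    for b = Q and b = q.  Their combination T_q is therefore the sum of the
    c(x, y) * Q ^ x * q ^ y over the grid x, y < K, where
    c(x, y) = (P - 1) * (P + 1 - (x ^ 2 - d y ^ 2 - 1) ^ 2) and P = 2 ^ w
    ([pack_identity]).  When (x, y) solves x ^ 2 - d y ^ 2 = 1 this is
    P ^ 2 - 1, with 2w binary ones; otherwise it is a multiple of P - 1 by an
    integer of [1, P], with exactly w binary ones ([popcount_digit]).  As
    Q = q1 * q2, dividing by q2 - 1 spreads row x over x disjoint blocks of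
    digits ([packed_quotient]), so a grid point is counted x times: the weight
    of M is w times the sum over the grid of x, plus w times the sum A of the
    abscissae of the solutions ([popcount_packed]).

    Weight.  The 2-adic valuation of C(2m, m) is the number of binary ones of m
    ([logn_central_bin]).  The H subroutine reads C(2m, m) as a digit of
    (L + 1) ^ (2m), then its gcd with 2 ^ (2m) as a digit of a quotient that
    counts lattice points ([gcd_quotient]), and finally the exponent of this
    power of 2 as a digit in base 2 ^ (2m) - 1 ([expn_digit]).

    Ordinates.  Every solution is a power of the fundamental one
    ([pell_complete]), so A = X_0 + ... + X_n where X_n is the last abscissa
    below K; let B = Y_0 + ... + Y_n.  Then A / sqrt d exceeds B by less than 1,
    with room to spare, and C(2dK, dK) / (4 ^ (dK - K) * C(2K, K)) is slightly
    above 1 / sqrt d.  The quotient of the C subroutine is thus B.  Without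
    square roots this reads d * B ^ 2 <= A ^ 2 ([pell_sum_ge]) and [pell_sum_lt],
    combined with the two monotone quantities of [central_bin_ge] and
    [central_bin_le].

    Recovery.  Writing E = A + B sqrt d = 1 + e + ... + e ^ n for the powers of
    the fundamental unit e, the integer c = A ^ 2 - A - d B ^ 2 satisfies
    e = (c + B sqrt d) / (c - B sqrt d), because (A, B) stays on the conic of
    [pell_sum_conic].  Rationalising gives the two quotients of the R subroutine
    ([recover_R_value]).

    Sizes.  Let W = w K ^ 3 + w d K ^ 2.  The powers with a variable exponent that
    occur outside the H subroutine are at most 2 ^ (6 W), and the remaining
    operations are bounded in number; a bound 2 ^ (a * W) with an explicit a is
    propagated through each of them while the program is evaluated
    ([runs_QO]). *)

(** * Counting binary ones *)

(** Bits of index m and above vanish because m < 2 ^ m, so the range of the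
    sum covers them all. *)
Definition popcount (m : nat) : nat := \sum_(i < m) odd (m %/ 2 ^ i).

Lemma popcount_widen m n : m <= n -> popcount m = \sum_(i < n) odd (m %/ 2 ^ i).
Proof.
move=> le_mn; rewrite /popcount -!(big_mkord xpredT (fun i => odd (m %/ 2 ^ i) : nat)).
rewrite (@big_cat_nat _ _ _ m 0 n) //= [X in _ = _ + X]big_nat_cond.
rewrite [X in _ = _ + X]big1 ?addn0 // => i /andP[/andP[le_mi _] _].
by rewrite divn_small // (leq_ltn_trans le_mi) // ltn_expl.
Qed.

Lemma popcount0 : popcount 0 = 0. Proof. by rewrite /popcount big_ord0. Qed.

Lemma popcount_bit (b : bool) k : popcount (b + k.*2) = b + popcount k.
Proof.
rewrite (@popcount_widen _ (b + k.*2).+1) // big_ord_recl /= divn1.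
rewrite oddD odd_double addbF oddb; congr (_ + _).
rewrite (@popcount_widen k (b + k.*2)); last by rewrite -addnn; lia.
by apply: eq_bigr => i _; rewrite /bump /= add1n expnS divnMA divn2 half_bit_double.
Qed.

Lemma popcount_le m : popcount m <= m.
Proof.
rewrite /popcount -[leqRHS]card_ord -sum1_card leq_sum // => i _; exact: leq_b1.
Qed.

Lemma popcount_shift n a b : a < 2 ^ n -> popcount (a + 2 ^ n * b) = popcount a + popcount b.
Proof.
elim: n a => [|n IHn] a; first by case: a => // _; rewrite mul1n popcount0.
rewrite expnS => lt_a.
rewrite -(odd_double_half a) -addnA -mulnA mul2n -doubleD !popcount_bit IHn ?addnA //.
by have := odd_double_half a; rewrite -addnn; lia.
Qed.

(** Subtracting from the all-ones word flips every bit. *)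
Lemma popcount_compl n k : k < 2 ^ n -> popcount (2 ^ n - k.+1) + popcount k = n.
Proof.
elim: n k => [|n IHn] k; first by case: k => // _; rewrite popcount0.
rewrite expnS => lt_k; have k_eq := odd_double_half k.
have lt_h : k./2 < 2 ^ n by move: k_eq; rewrite -addnn; lia.
have -> : 2 * 2 ^ n - k.+1 = ~~ odd k + (2 ^ n - (k./2).+1).*2.
  by move: k_eq; case: (odd k) => /=; rewrite -!addnn; lia.
rewrite -{3}k_eq !popcount_bit addnACA IHn //; by case: (odd k).
Qed.

Lemma popcount_ones n : popcount (2 ^ n - 1) = n.
Proof. by rewrite -{2}(@popcount_compl n 0) ?expn_gt0 // popcount0 addn0. Qed.

(** With m = k + 1, the product is (2 ^ n - 1 - k) + 2 ^ n * k: its low word is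
    the complement of its high word. *)
Lemma popcount_mul_ones n m : 0 < m <= 2 ^ n -> popcount ((2 ^ n - 1) * m) = n.
Proof.
case: m => // m /= le_m.
have -> : (2 ^ n - 1) * m.+1 = 2 ^ n - m.+1 + 2 ^ n * m by rewrite mulnBl mul1n mulnS; lia.
by rewrite popcount_shift ?popcount_compl //; lia.
Qed.

Lemma digits_lt b n (f : nat -> nat) :
  (forall i, i < n -> f i < b) -> \sum_(i < n) f i * b ^ i < b ^ n.
Proof.
elim: n => [|n IHn] f_lt; first by rewrite big_ord0.
rewrite big_ord_recr /= expnS.
have := IHn (fun i lt_i => f_lt i (ltnW lt_i)).
have := f_lt n (ltnSn n).
move: (f n) (b ^ n) (\sum_(i < n) _) => fn bn s; nia.
Qed.

(** Digits in base 2 ^ l occupy disjoint blocks of bits. *)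
Lemma popcount_digits l n (f : nat -> nat) : (forall i, i < n -> f i < 2 ^ l) ->
  popcount (\sum_(i < n) f i * (2 ^ l) ^ i) = \sum_(i < n) popcount (f i).
Proof.
elim: n => [|n IHn] f_lt; first by rewrite !big_ord0 popcount0.
have f_lt' i : i < n -> f i < 2 ^ l by move/ltnW; apply: f_lt.
rewrite !big_ord_recr /= -(IHn f_lt') mulnC -expnM popcount_shift //.
rewrite expnM; exact: digits_lt.
Qed.

Lemma logn_fact_double m : logn 2 (m.*2)`! = m + logn 2 m`!.
Proof.
elim: m => [|m IHm] //.
rewrite doubleS !factS !lognM ?muln_gt0 ?fact_gt0 // IHm.
have -> : logn 2 (m.*2).+1 = 0 by rewrite lognE /= dvdn2 /= odd_double.
have -> : logn 2 (m.*2).+2 = (logn 2 m.+1).+1.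
  by rewrite -doubleS -mul2n lognM // logn_prime.
lia.
Qed.

(** Legendre's formula for the prime 2, by induction on the halves of m. *)
Lemma logn_fact_popcount m : logn 2 m`! + popcount m = m.
Proof.
elim/ltn_ind: m => -[|m] IHm; first by rewrite popcount0.
have m_eq := odd_double_half m.+1; set k := (m.+1)./2 in m_eq *.
have lt_k : k < m.+1 by move: m_eq; rewrite -addnn; lia.
have := IHm k lt_k.
rewrite -m_eq popcount_bit.
case: (odd m.+1) => /=; rewrite ?add1n ?add0n.
- rewrite factS lognM ?fact_gt0 // logn_fact_double.
  have -> : logn 2 (k.*2).+1 = 0 by rewrite lognE /= dvdn2 /= odd_double.
  rewrite -addnn; lia.
- rewrite logn_fact_double -addnn; lia.
Qed.

(** * Central binomial coefficients *)

Definition central_bin n := 'C(2 * n, n).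

Lemma central_bin_gt0 n : 0 < central_bin n. Proof. by rewrite bin_gt0; lia. Qed.

Lemma central_bin_fact n : central_bin n * (n`! * n`!) = (2 * n)`!.
Proof. by rewrite -(@bin_fact (2 * n) n); [do 3 f_equal|]; lia. Qed.

(** Kummer's theorem for the sum m + m, in which each binary one of m produces a
    carry. *)
Lemma logn_central_bin m : logn 2 (central_bin m) = popcount m.
Proof.
have := central_bin_fact m; move/(congr1 (logn 2)).
rewrite mul2n logn_fact_double !lognM ?muln_gt0 ?fact_gt0 ?central_bin_gt0 //.
have := logn_fact_popcount m; lia.
Qed.

Lemma gcdn_central_bin m : gcdn (central_bin m) (2 ^ (2 * m)) = 2 ^ popcount m.
Proof.
have /p_natP[k gk] : 2.-nat (gcdn (central_bin m) (2 ^ (2 * m))).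
  apply: (@pnat_dvd _ (2 ^ (2 * m))); first exact: dvdn_gcdr.
  by rewrite pnatX pnat_id.
rewrite gk; congr (2 ^ _); have := congr1 (logn 2) gk.
rewrite logn_gcd ?central_bin_gt0 ?expn_gt0 // logn_central_bin !pfactorK //.
have := popcount_le m; lia.
Qed.

Lemma central_bin_recr n : n.+1 * central_bin n.+1 = 2 * (2 * n).+1 * central_bin n.
Proof.
have h1 := central_bin_fact n; have := central_bin_fact n.+1.
have -> : 2 * n.+1 = (2 * n).+2 by lia.
rewrite !factS -h1 => h2.
have f0 : 0 < n`! * n`! * n.+1 by rewrite !muln_gt0 fact_gt0.
apply/eqP; rewrite -(eqn_pmul2r f0); apply/eqP; nia.
Qed.

(** The quantity n * C(2n, n) ^ 2 / 16 ^ n is nondecreasing, since its successive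
    ratios are (2n + 1) ^ 2 / (4 n (n + 1)). *)
Lemma central_bin_ge n m : n <= m -> n * central_bin n ^ 2 * 16 ^ (m - n) <= m * central_bin m ^ 2.
Proof.
elim: m => [|m IHm]; first by case: n.
rewrite leq_eqVlt => /predU1P[->|]; first by rewrite subnn muln1.
rewrite ltnS => le_nm; have := IHm le_nm; rewrite subSn // (expnS 16).
set X := n * _ * _ => leX; have := central_bin_recr m.
have -> : n * central_bin n ^ 2 * (16 * 16 ^ (m - n)) = 16 * X by rewrite /X; lia.
move=> e.
have e2 : m.+1 * (m.+1 * central_bin m.+1 ^ 2) = 4 * (2 * m).+1 ^ 2 * central_bin m ^ 2.
  transitivity ((m.+1 * central_bin m.+1) ^ 2); first by lia.
  by rewrite e; lia.
rewrite -(@leq_pmul2l m.+1) // e2.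
apply: (@leq_trans (m.+1 * (16 * (m * central_bin m ^ 2)))); first by nia.
have : 16 * m * m.+1 <= 4 * (2 * m).+1 ^ 2 by nia.
move/(leq_mul (leqnn (central_bin m ^ 2))); lia.
Qed.

(** The quantity (2n + 1) * C(2n, n) ^ 2 / 16 ^ n is nonincreasing, since its
    successive ratios are (2n + 1) (2n + 3) / (4 (n + 1) ^ 2). *)
Lemma central_bin_le n m : n <= m ->
  (2 * m).+1 * central_bin m ^ 2 <= (2 * n).+1 * central_bin n ^ 2 * 16 ^ (m - n).
Proof.
elim: m => [|m IHm]; first by case: n.
rewrite leq_eqVlt => /predU1P[->|]; first by rewrite subnn muln1.
rewrite ltnS => le_nm; have := IHm le_nm; rewrite subSn // (expnS 16).
set X := _ * 16 ^ (m - n) => leX; have := central_bin_recr m.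
have -> : (2 * n).+1 * central_bin n ^ 2 * (16 * 16 ^ (m - n)) = 16 * X by rewrite /X; lia.
move=> e.
have e2 : m.+1 ^ 2 * central_bin m.+1 ^ 2 = 4 * (2 * m).+1 ^ 2 * central_bin m ^ 2.
  transitivity ((m.+1 * central_bin m.+1) ^ 2); first by lia.
  by rewrite e; lia.
rewrite -(@leq_pmul2l (m.+1 ^ 2)) ?expn_gt0 //.
apply: (@leq_trans (16 * m.+1 ^ 2 * ((2 * m).+1 * central_bin m ^ 2))); last by nia.
have : (2 * m.+1).+1 * (2 * m).+1 <= 4 * m.+1 ^ 2 by nia.
move/(leq_mul (leqnn (4 * (2 * m).+1 * central_bin m ^ 2))).
have -> : m.+1 ^ 2 * ((2 * m.+1).+1 * central_bin m.+1 ^ 2) = (2 * m.+1).+1 * (m.+1 ^ 2 * central_bin m.+1 ^ 2) by lia.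
rewrite e2; lia.
Qed.

(** The row of index 2n of Pascal's triangle sums to 4 ^ n and has at least two
    positive entries. *)
Lemma bin_lt_4exp n i : 0 < n -> 'C(2 * n, i) < 4 ^ n.
Proof.
move=> n_gt0; have -> : 4 ^ n = \sum_(j < (2 * n).+1) 'C(2 * n, j).
  by rewrite -[4]/((1 + 1) ^ 2) -expnM expnDn; apply: eq_bigr => j _; rewrite !exp1n !muln1.
case: (ltnP (2 * n) i) => [gt_i|le_i]; first by rewrite bin_small // big_ord_recl bin0; lia.
rewrite (bigD1 (inord i)) //= inordK // -addn1 leq_add2l.
have [i0|i_n0] := eqVneq i 0.
  by rewrite (bigD1 ord_max) /= ?binn ?leq_addr // -val_eqE /= inordK // i0; lia.
by rewrite (bigD1 ord0) /= ?bin0 ?leq_addr // -val_eqE /= inordK // eq_sym.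
Qed.

(** All the coefficients of (p + 1) ^ (2n) are below p, hence are its digits in
    base p; the quotient and the remainder isolate the middle one. *)
Lemma central_bin_extract p n : 0 < n -> 4 ^ n <= p -> ((p + 1) ^ (2 * n) %/ p ^ n) %% p = central_bin n.
Proof.
move=> n_gt0 le_p; have p_gt0 : 0 < p by rewrite (leq_trans _ le_p) // expn_gt0.
have lt_bin i : 'C(2 * n, i) < p by rewrite (leq_trans _ le_p) // bin_lt_4exp.
have -> : (p + 1) ^ (2 * n) = \sum_(i < n) 'C(2 * n, i) * p ^ i
     + p ^ n * (central_bin n + p * \sum_(i < n) 'C(2 * n, n + i.+1) * p ^ i).
  rewrite addnC expnDn; under eq_bigr do rewrite exp1n mul1n.
  have -> : (2 * n).+1 = n + n.+1 by lia.
  rewrite big_split_ord /=; congr (_ + _).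
  rewrite big_ord_recl /= addn0 mulnDr mulnC; congr (_ + _); rewrite -/(central_bin n).
  rewrite !big_distrr /=; apply: eq_bigr => i _.
  by rewrite /bump /= add1n expnD expnS; lia.
rewrite addnC mulnC divnMDl ?expn_gt0 ?p_gt0 //.
rewrite divn_small ?addn0; last by apply: digits_lt.
by rewrite addnC mulnC modnMDl modn_small // lt_bin.
Qed.

(** * The greatest common divisor as a digit of a quotient *)

Lemma geometric b n : 0 < b -> (b - 1) * \sum_(i < n) b ^ i + 1 = b ^ n.
Proof.
move=> b_gt0; rewrite subn1 -predn_exp addn1 prednK // expn_gt0 b_gt0 //.
Qed.

(** With g = gcd(a, b), the condition says that b / g divides i, and the interval
    [0, b] contains g + 1 multiples of b / g. *)
Lemma sum_dvdn_gcd a b : 0 < a -> 0 < b ->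
  \sum_(i < b.+1) (b %| a * i) = (gcdn a b).+1.
Proof.
move=> a_gt0 b_gt0; set g := gcdn a b.
have g_gt0 : 0 < g by rewrite gcdn_gt0 a_gt0.
have [a' a_eq] : exists a', a = a' * g by apply/dvdnP/dvdn_gcdl.
have [e b_eq] : exists e, b = e * g by apply/dvdnP/dvdn_gcdr.
have e_gt0 : 0 < e by move: b_gt0; rewrite b_eq muln_gt0 => /andP[].
have co : coprime e a'.
  have : gcdn a b = 1 * g by rewrite mul1n.
  rewrite {1}a_eq {1}b_eq -muln_gcdl => /eqP; rewrite eqn_pmul2r // => /eqP h.
  by rewrite /coprime gcdnC h.
rewrite big_ord_recl /= muln0 dvdn0 add1n; congr _.+1.
transitivity (\sum_(1 <= i < b.+1) (e %| i)).
  rewrite big_add1 big_mkord; apply: eq_bigr => i _.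
  rewrite /bump /= add1n {1}b_eq a_eq -mulnA [g * _]mulnC mulnA dvdn_pmul2r //.
  by rewrite Gauss_dvdr.
by rewrite -divn_count_dvd b_eq mulKn.
Qed.

(** The left-hand side is the remainder of the division in [gcd_quotient]; the
    exponents below b keep the sum well under x ^ b. *)
Lemma gcd_quotient_bound x a b : 2 ^ b <= x -> 4 <= b -> 0 < a ->
  (x ^ a - 1) * \sum_(i < b.+1) x ^ (a * i %% b) + x ^ b < (x ^ a - 1) * (x ^ b - 1).
Proof.
move=> le_x le_b a_gt0; case: b le_x le_b => // b le_x le_b.
have lt_b : b.+1 < 2 ^ b.
  move: (b) le_b => [|[|[|c]]] // _; elim: c => // c IHc; rewrite expnS; lia.
have le_sum : \sum_(i < b.+2) x ^ (a * i %% b.+1) <= b.+2 * x ^ b.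
  rewrite -[X in X * _]card_ord -sum_nat_const leq_sum // => i _.
  rewrite leq_exp2l; first by rewrite -ltnS ltn_mod.
  by apply: leq_trans le_x; rewrite expnS; lia.
have x_ge : 2 * b.+2 <= x by apply: leq_trans le_x; rewrite expnS; lia.
have le_xa : x <= x ^ a by rewrite -[leqLHS]expn1 leq_pexp2l //; lia.
have y_gt0 : 4 <= x ^ b.
  apply: (@leq_trans (x ^ 1)); first by lia.
  by rewrite leq_pexp2l //; lia.
rewrite expnS; move: (x ^ a) (x ^ b) (\sum_(i < _) _) le_sum le_xa y_gt0 => A Y S.
move=> le_sum le_xa y4.
have : S + 2 * Y <= x * Y - 1 by nia.
have h : x * Y <= (A - 1) * (2 * Y) - 1 by nia.
nia.
Qed.

(** The quotient expands as the sum of the x ^ (a b - a i - b j), truncated at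
    nonnegative exponents.  Modulo x only the exponent 0 remains, so the digit
    counts the lattice points of the segment a i + b j = a b, which are
    gcd(a, b) + 1. *)
Lemma gcd_quotient x a b : 2 ^ b <= x -> 4 <= b -> 0 < a ->
  (x ^ (a * b + a + b) %/ ((x ^ a - 1) * (x ^ b - 1))) %% x = (gcdn a b).+1.
Proof.
move=> le_x le_b a_gt0; have b_gt0 : 0 < b by lia.
have x_gt0 : 0 < x by apply: leq_trans le_x; rewrite expn_gt0.
have lt_bx : b.+1 < x.
  apply: leq_trans le_x; move: (b) le_b => [|[|c]] // _.
  elim: c => // c IHc; rewrite (expnS _ c.+2); lia.
pose k i := a * i %/ b; pose r i := a * i %% b.
pose q := \sum_(i < b.+1) \sum_(j < (k i).+1) x ^ (r i + b * j).
have num_eq : x ^ (a * b + a + b) = q * ((x ^ a - 1) * (x ^ b - 1))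
    + ((x ^ a - 1) * \sum_(i < b.+1) x ^ r i + x ^ b).
  have -> : a * b + a + b = a * b.+1 + b by lia.
  rewrite expnD expnM -(@geometric (x ^ a) b.+1) ?expn_gt0 ?x_gt0 // mulnDl mul1n.
  rewrite addnA; congr (_ + _).
  rewrite [q * _]mulnC -!mulnA -mulnDr; congr (_ * _).
  rewrite /q big_distrl big_distrr -big_split /=; apply: eq_bigr => i _.
  rewrite -expnM -expnD.
  have -> : a * i + b = r i + b * (k i).+1 by rewrite {1}(divn_eq (a * i) b) /r /k; lia.
  rewrite expnD expnM -(@geometric (x ^ b) (k i).+1) ?expn_gt0 ?x_gt0 //.
  rewrite mulnDr muln1; congr (_ + _).
  rewrite mulnCA; congr (_ * _); rewrite big_distrr; apply: eq_bigr => j _.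
  by rewrite expnD expnM.
have lt_rem := @gcd_quotient_bound x a b le_x le_b a_gt0.
rewrite num_eq divnMDl; last by apply: leq_ltn_trans lt_rem.
rewrite divn_small // addn0.
(* The terms of [q] with a positive exponent, each divided by x. *)
pose q' := \sum_(i < b.+1) \sum_(j < (k i).+1) ((r i + b * j > 0) * x ^ (r i + b * j).-1).
have -> : q = q' * x + \sum_(i < b.+1) (b %| a * i).
  rewrite /q /q' big_distrl -big_split /=; apply: eq_bigr => i _.
  have -> : (b %| a * i) = \sum_(j < (k i).+1) (r i + b * j == 0) :> nat.
    rewrite big_ord_recl muln0 addn0 /dvdn -/(r i) big1 ?addn0 // => j _.
    by rewrite addn_eq0 muln_eq0 (gtn_eqF b_gt0) andbF.
  rewrite big_distrl -big_split /=; apply: eq_bigr => j _.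
  by case: (r i + b * j) => [|s] //=; rewrite mul1n addn0 expnS mulnC.
rewrite modnMDl sum_dvdn_gcd // modn_small //.
apply: leq_ltn_trans lt_bx; rewrite ltnS dvdn_leq // dvdn_gcdr //.
Qed.

Lemma expn_mod_sqr u s : exists k, (u + 1) ^ s = 1 + s * u + k * u ^ 2.
Proof.
elim: s => [|s [k IHs]]; first by exists 0; rewrite expn0; lia.
by exists (k * (u + 1) + s); rewrite expnS IHs; lia.
Qed.

(** By the binomial theorem (u + 1) ^ s is 1 + s u modulo u ^ 2. *)
Lemma expn_digit u s : s < u -> 1 < u -> ((u + 1) ^ s %% u ^ 2) %/ u = s.
Proof.
move=> lt_s u_gt1; have [k ->] := expn_mod_sqr u s.
rewrite addnC modnMDl modn_small; last by nia.
by rewrite addnC divnMDl ?(ltnW u_gt1) // divn_small ?addn0.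
Qed.

(** * The Hamming-weight subroutine *)

Lemma result_bind (A B : Type) (m : Defs.comp A) (k : A -> Defs.comp B) a :
  result m = Some a -> result (bind m k) = result (k a).
Proof. by move=> m_eq; rewrite /bind m_eq. Qed.

Lemma result_binop f (e1 e2 : expr) x y :
  result e1 = Some x -> result e2 = Some y -> result (binop f e1 e2) = f x y.
Proof. by move=> h1 h2; rewrite /binop (result_bind _ h1) (result_bind _ h2). Qed.

(** With g = 2 ^ s, where s is the weight of m, the last step uses
    g ^ (2m) = (2 ^ (2m)) ^ s = (u + 1) ^ s. *)
Lemma result_hamming m : 0 < m -> result (hamming m) = Some (popcount m).
Proof.
move=> m_gt0; set a := 2 * m; set L := 2 ^ a; set alpha := central_bin m.
have L_eq : L = 4 ^ m by rewrite /L /a expnM.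
have L_ge4 : 4 <= L by rewrite L_eq -[leqLHS]expn1 leq_pexp2l.
have lt_mL : m.+1 < L by apply: leq_ltn_trans (ltn_expl a (isT : 1 < 2)); rewrite /a; lia.
have alpha_gt0 : 0 < alpha := central_bin_gt0 m.
set gamma := alpha * L.
have gamma_gt0 : 0 < gamma by rewrite muln_gt0 alpha_gt0; lia.
have pow_gt1 k : 0 < k -> 1 < 2 ^ (gamma * k).
  by move=> k_gt0; rewrite -[ltnLHS](expn0 2) ltn_exp2l // muln_gt0 gamma_gt0.
rewrite /hamming.
rewrite (@result_bind _ _ _ _ a); last by [].
rewrite (@result_bind _ _ _ _ L); last by [].
rewrite (@result_bind _ _ _ _ alpha); last first.
  rewrite (@result_binop _ _ _ ((L + 1) ^ a %/ L ^ m) L) //; last first.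
    rewrite (@result_binop _ _ _ ((L + 1) ^ a) (L ^ m)) //.
    by rewrite expn_eq0; case: eqP => //; lia.
  case: eqP => [|_]; first by lia.
  by rewrite /a central_bin_extract // L_eq.
rewrite (@result_bind _ _ _ _ a); last by [].
rewrite (@result_bind _ _ _ _ L); last by [].
rewrite (@result_bind _ _ _ _ gamma); last by [].
rewrite (@result_bind _ _ _ _ (2 ^ popcount m)); last first.
  set num := 2 ^ (gamma * (gamma + alpha + L)).
  set den := (2 ^ (gamma * alpha) - 1) * (2 ^ (gamma * L) - 1).
  rewrite (@result_binop _ _ _ ((num %/ den) %% 2 ^ gamma) 1) //; last first.
    rewrite (@result_binop _ _ _ (num %/ den) (2 ^ gamma)) //; last first.
      rewrite (@result_binop _ _ _ num den) //.
      have /gtn_eqF-> // : 0 < den.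
      by rewrite muln_gt0 !subn_gt0 !pow_gt1 // (leq_trans _ L_ge4).
    by rewrite expn_eq0.
  rewrite /num /den !expnM gcd_quotient // ?gcdn_central_bin ?subn1 //.
  by rewrite -(expnM 2 alpha) leq_exp2l // leq_pmull.
rewrite (@result_bind _ _ _ _ (L - 1)); last by [].
set u := L - 1.
rewrite (@result_binop _ _ _ ((2 ^ popcount m) ^ a %% u ^ 2) u) //; last first.
  rewrite (@result_binop _ _ _ ((2 ^ popcount m) ^ a) (u ^ 2)) //.
  by rewrite expn_eq0; case: eqP => //; rewrite /u; lia.
case: eqP => [|_]; first by rewrite /u; lia.
have -> : (2 ^ popcount m) ^ a = (u + 1) ^ popcount m.
  by rewrite subnK ?(leq_trans _ L_ge4) // /L -!expnM mulnC.
rewrite expn_digit // /u; have := popcount_le m; lia.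
Qed.

(** * Solutions of the Pell equation and their partial sums *)

Section Pell.
Variables d X1 Y1 : nat.
Hypothesis d_ge2 : 2 <= d.
Hypothesis fund : fundamental_solution d X1 Y1.

Lemma pell_solutionE x y : pell_solution d x y <-> 0 < y /\ x ^ 2 = d * y ^ 2 + 1.
Proof. by split=> [[x_gt0 y_gt0 e]|[y_gt0 e]]; [split=> // | split=> //]; lia. Qed.

Lemma fund_gt0 : 0 < Y1. Proof. by case: fund => /pell_solutionE[]. Qed.

Lemma fund_eq : X1 ^ 2 = d * Y1 ^ 2 + 1. Proof. by case: fund => /pell_solutionE[]. Qed.

Lemma fund_ge2 : 2 <= X1.
Proof. have := fund_gt0; have := fund_eq; nia. Qed.

(** Coordinates of the powers of X1 + Y1 sqrt d. *)
Fixpoint pell_power (n : nat) : nat * nat :=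
  if n is m.+1 then
    let: (x, y) := pell_power m in (X1 * x + d * Y1 * y, Y1 * x + X1 * y)
  else (1, 0).

Definition pell_x n := (pell_power n).1.
Definition pell_y n := (pell_power n).2.

Lemma pell_xS n : pell_x n.+1 = X1 * pell_x n + d * Y1 * pell_y n.
Proof. by rewrite /pell_x /pell_y /=; case: (pell_power n). Qed.

Lemma pell_yS n : pell_y n.+1 = Y1 * pell_x n + X1 * pell_y n.
Proof. by rewrite /pell_x /pell_y /=; case: (pell_power n). Qed.

Lemma pell_norm n : pell_x n ^ 2 = d * pell_y n ^ 2 + 1.
Proof.
elim: n => [|n IHn]; first by rewrite /pell_x /pell_y /= muln0.
rewrite pell_xS pell_yS; have e := fund_eq.
move: (pell_x n) (pell_y n) IHn => x y IHn; nia.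
Qed.

Lemma pell_x_gt0 n : 0 < pell_x n.
Proof. by have := pell_norm n; case: (pell_x n) => //; lia. Qed.

Lemma pell_x_double n : 2 * pell_x n <= pell_x n.+1.
Proof. rewrite pell_xS; have := fund_ge2; nia. Qed.

Lemma pell_x_lt n : pell_x n < pell_x n.+1.
Proof. have := pell_x_double n; have := pell_x_gt0 n; lia. Qed.

Lemma pell_x_mono : {mono pell_x : m n / m < n}.
Proof. apply/leqW_mono/leq_mono; apply: homo_ltn => [|n]; [exact: ltn_trans | exact: pell_x_lt]. Qed.

Lemma pell_x_inj : injective pell_x.
Proof. by move=> m n e; case: (ltngtP m n) => //; rewrite -pell_x_mono e ltnn. Qed.

Lemma pell_x_ge n : n < pell_x n.
Proof. elim: n => [|n IHn] //; apply: leq_ltn_trans IHn (pell_x_lt n). Qed.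

(** Descent: multiplying a solution other than (1, 0) by the conjugate
    X1 - Y1 sqrt d gives a smaller one, with nonnegative coordinates because X1 is
    minimal. *)
Lemma pell_complete x y : x ^ 2 = d * y ^ 2 + 1 -> exists n, x = pell_x n /\ y = pell_y n.
Proof.
elim/ltn_ind: x y => x IHx y sol.
have [y0|y_gt0] := posnP y.
  by exists 0; rewrite /pell_x /pell_y /=; move: sol; rewrite y0; split=> //; nia.
(* Minimality orders the abscissae, hence the ordinates, which keeps the second
   coordinate of the conjugate product nonnegative. *)
have le_X1 : X1 <= x by case: fund => _ /(_ x y) minX; apply: minX; apply/pell_solutionE.
have e := fund_eq; have Y1_gt0 := fund_gt0; have X1_ge2 := fund_ge2.
have le_Y1 : Y1 <= y.
  have : d * Y1 ^ 2 <= d * y ^ 2 by nia.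
  by rewrite leq_pmul2l ?leq_sqr; lia.
have lex : d * Y1 * y <= X1 * x.
  rewrite -leq_sqr !expnMn e sol; lia.
have ley : Y1 * x <= X1 * y.
  rewrite -leq_sqr !expnMn e sol; have : Y1 ^ 2 <= y ^ 2 by rewrite leq_sqr.
  lia.
have [x' x'E] : exists x', X1 * x = x' + d * Y1 * y by exists (X1 * x - d * Y1 * y); lia.
have [y' y'E] : exists y', X1 * y = y' + Y1 * x by exists (X1 * y - Y1 * x); lia.
have xE : x = X1 * x' + d * Y1 * y'.
  suff : X1 ^ 2 * x + d * Y1 * (X1 * y) = X1 * x' + d * Y1 * y' + x * (d * Y1 ^ 2) + d * Y1 * (X1 * y) by nia.
  transitivity (X1 * (X1 * x) + d * Y1 * (X1 * y)); first by lia.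
  rewrite [in X1 * (X1 * x)]x'E [in d * Y1 * (X1 * y)]y'E; lia.
have yE : y = Y1 * x' + X1 * y'.
  suff : X1 ^ 2 * y + Y1 * (X1 * x) = Y1 * x' + X1 * y' + y * (d * Y1 ^ 2) + Y1 * (X1 * x) by nia.
  transitivity (X1 * (X1 * y) + Y1 * (X1 * x)); first by lia.
  rewrite [in X1 * (X1 * y)]y'E [in Y1 * (X1 * x)]x'E; lia.
have sol' : x' ^ 2 = d * y' ^ 2 + 1.
  have h : x ^ 2 + (d * Y1 ^ 2) * x' ^ 2 + X1 ^ 2 * (d * y' ^ 2)
    = d * y ^ 2 + X1 ^ 2 * x' ^ 2 + (d * Y1 ^ 2) * (d * y' ^ 2).
    by rewrite {1}xE {1}yE; lia.
  by move: h; rewrite sol e; lia.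
have x'_gt0 : 0 < x' by move: sol'; case: (x') => //; lia.
have lt_x' : x' < x.
  have : 2 * x' <= X1 * x' by rewrite leq_mul2r X1_ge2 orbT.
  lia.
have [n [x'n y'n]] := IHx x' lt_x' y' sol'.
by exists n.+1; rewrite pell_xS pell_yS -x'n -y'n.
Qed.

(** With [pell_sum_y], the coordinates of 1 + e + ... + e ^ n for
    e = X1 + Y1 sqrt d. *)
Definition pell_sum_x n := \sum_(i < n.+1) pell_x i.
Definition pell_sum_y n := \sum_(i < n.+1) pell_y i.

Lemma pell_sum_xS n : pell_sum_x n.+1 = 1 + X1 * pell_sum_x n + d * Y1 * pell_sum_y n.
Proof.
rewrite /pell_sum_x big_ord_recl -addnA !big_distrr -big_split /=.
by congr (_ + _); apply: eq_bigr => i _; rewrite -pell_xS.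
Qed.

Lemma pell_sum_yS n : pell_sum_y n.+1 = Y1 * pell_sum_x n + X1 * pell_sum_y n.
Proof.
rewrite /pell_sum_y big_ord_recl add0n !big_distrr -big_split /=.
by apply: eq_bigr => i _; rewrite -pell_yS.
Qed.

Lemma pell_sum_x0 : pell_sum_x 0 = 1. Proof. by rewrite /pell_sum_x big_ord_recl big_ord0. Qed.
Lemma pell_sum_y0 : pell_sum_y 0 = 0. Proof. by rewrite /pell_sum_y big_ord_recl big_ord0. Qed.

(** The conic Y1 * (A ^ 2 - A - d B ^ 2) = (X1 + 1) * B is stable under the
    affine map E -> 1 + e E that sends one partial sum to the next one. *)
Lemma pell_sum_conic n : exists c,
  pell_sum_x n ^ 2 = pell_sum_x n + c + d * pell_sum_y n ^ 2 /\ Y1 * c = (X1 + 1) * pell_sum_y n.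
Proof.
elim: n => [|n [c [eA ec]]]; first by exists 0; rewrite pell_sum_x0 pell_sum_y0; lia.
exists (c + pell_sum_x n + X1 * pell_sum_x n + d * Y1 * pell_sum_y n).
rewrite pell_sum_xS pell_sum_yS; have e := fund_eq.
move: (pell_sum_x n) (pell_sum_y n) eA ec => A B eA ec; split.
  (* Both sides are expanded so that X1 ^ 2 and d * Y1 ^ 2 appear as such, ready
     for the Pell relation. *)
  have -> : (1 + X1 * A + d * Y1 * B) ^ 2 = 1 + 2 * (X1 * A + d * Y1 * B) + X1 ^ 2 * A ^ 2
     + (d * Y1 ^ 2) * (d * B ^ 2) + 2 * X1 * A * (d * Y1 * B) by lia.
  have -> : d * (Y1 * A + X1 * B) ^ 2 = (d * Y1 ^ 2) * A ^ 2 + X1 ^ 2 * (d * B ^ 2) + 2 * X1 * A * (d * Y1 * B) by lia.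
  rewrite e eA; lia.
have -> : Y1 * (c + A + X1 * A + d * Y1 * B) = Y1 * c + Y1 * (X1 + 1) * A + (d * Y1 ^ 2) * B by lia.
rewrite ec; have -> : (X1 + 1) * (Y1 * A + X1 * B) = Y1 * (X1 + 1) * A + X1 ^ 2 * B + X1 * B by lia.
rewrite e; lia.
Qed.

Lemma pell_sum_ge n : d * pell_sum_y n ^ 2 <= pell_sum_x n ^ 2.
Proof. by have [c [-> _]] := pell_sum_conic n; rewrite leq_addl. Qed.

Lemma pell_sum_y_gt0 n : 0 < n -> Y1 <= pell_sum_y n.
Proof.
case: n => // n _; rewrite pell_sum_yS; suff : 0 < pell_sum_x n by nia.
by rewrite /pell_sum_x big_ord_recl.
Qed.

(** Multiply by X1 + 1 and replace d * Y1 ^ 2 by (X1 - 1) (X1 + 1). *)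
Lemma pell_sum_conic_dual n c : Y1 * c = (X1 + 1) * pell_sum_y n ->
  d * Y1 * pell_sum_y n + c = X1 * c.
Proof.
move=> ec; have e := fund_eq; have Y1_gt0 := fund_gt0; have X1_ge2 := fund_ge2.
apply/eqP; rewrite -(@eqn_pmul2l (X1 + 1)) ?addn1 // -addn1; apply/eqP.
have -> : (X1 + 1) * (d * Y1 * pell_sum_y n + c) = d * Y1 * ((X1 + 1) * pell_sum_y n) + (X1 + 1) * c by lia.
have -> : (X1 + 1) * (X1 * c) = X1 ^ 2 * c + X1 * c by lia.
rewrite -ec e; lia.
Qed.

(** The two forms of the conic say that c + B sqrt d is the product of
    X1 + Y1 sqrt d by c - B sqrt d; multiplying by c + B sqrt d gives the values of
    X1 and Y1 as exact quotients by the norm of c + B sqrt d. *)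
Lemma recover_R_value n A B c : 0 < n -> A = pell_sum_x n -> B = pell_sum_y n ->
  c = (A * A - A) - d * (B * B) ->
  [/\ 0 < c * c - d * (B * B),
      (c * c + d * (B * B)) %/ (c * c - d * (B * B)) = X1 &
      (2 * B * c) %/ (c * c - d * (B * B)) = Y1].
Proof.
move=> n_gt0 AE BE cE; have X1_ge2 := fund_ge2; have Y1_gt0 := fund_gt0.
have [c' [eA ec]] := pell_sum_conic n.
have {cE} cc' : c = c' by rewrite cE AE BE; lia.
rewrite -{}cc' -AE -BE in eA ec.
have := @pell_sum_conic_dual n c; rewrite -BE => /(_ ec) ed.
have B_gt0 : 0 < B by rewrite BE (leq_trans Y1_gt0) ?pell_sum_y_gt0.
have eq_sq : X1 * (c * c) = c * c + (X1 + 1) * (d * (B * B)).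
  have : c * (X1 * c) = c * (d * Y1 * B + c) by rewrite ed.
  have : d * B * (Y1 * c) = d * B * ((X1 + 1) * B) by rewrite ec.
  lia.
have lt_D : d * (B * B) < c * c.
  have : 0 < d * (B * B) by nia.
  nia.
have [D DE] : exists D, c * c = D + d * (B * B) by exists (c * c - d * (B * B)); lia.
have D_gt0 : 0 < D by lia.
rewrite DE addnK; split=> //.
  have -> : D + d * (B * B) + d * (B * B) = X1 * D by move: eq_sq; rewrite DE; lia.
  by rewrite mulnK.
have -> : 2 * B * c = Y1 * D; last by rewrite mulnK.
have : Y1 * (c * c) = (X1 + 1) * (B * c).
  have : c * (Y1 * c) = c * ((X1 + 1) * B) by rewrite ec.
  lia.
have : B * (d * Y1 * B + c) = B * (X1 * c) by rewrite ed.
rewrite DE; lia.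
Qed.

(** The last term of the sum in terms of the sum itself, by solving
    E' = 1 + e E for the previous sum E. *)
Lemma pell_x_sum n : 0 < n ->
  pell_x n + X1 * pell_sum_x n = pell_sum_x n + X1 + d * Y1 * pell_sum_y n.
Proof.
case: n => // n _; have e := fund_eq.
have h1 : pell_sum_x n.+1 = pell_sum_x n + pell_x n.+1 by rewrite /pell_sum_x big_ord_recr.
have h2 := pell_sum_xS n; have h3 := pell_sum_yS n.
have h4 : d * Y1 * pell_sum_y n.+1 = (d * Y1 ^ 2) * pell_sum_x n + X1 * (d * Y1 * pell_sum_y n) by rewrite h3; lia.
have h5 : X1 * pell_sum_x n.+1 = X1 + X1 ^ 2 * pell_sum_x n + X1 * (d * Y1 * pell_sum_y n) by rewrite h2; lia.
rewrite h4 h5 h1 e; lia.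
Qed.

(** The first abscissa 1 is at most half of X1, and from then on each abscissa
    is at least three times the previous one, which preserves the ratio 3 / 2. *)
Lemma pell_sum_x_le n : 0 < n -> 2 * pell_sum_x n <= 3 * pell_x n.
Proof.
have X1_ge2 := fund_ge2; case: n => // n _; elim: n => [|n IHn].
  by rewrite pell_sum_xS pell_sum_x0 pell_sum_y0 pell_xS /pell_x /pell_y /=; lia.
have -> : pell_sum_x n.+2 = pell_sum_x n.+1 + pell_x n.+2 by rewrite /pell_sum_x big_ord_recr.
suff : 3 * pell_x n.+1 <= pell_x n.+2 by lia.
rewrite (pell_xS n.+1); have e := fund_eq; have Y1_gt0 := fund_gt0.
suff : pell_x n.+1 <= d * Y1 * pell_y n.+1.
  by move: (leq_mul X1_ge2 (leqnn (pell_x n.+1))); lia.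
rewrite pell_xS pell_yS.
have h : X1 <= d * Y1 ^ 2 by nia.
have := leq_mul h (leqnn (pell_x n)).
have := leq_mul (ltnW X1_ge2) (leqnn (d * Y1 * pell_y n)); lia.
Qed.

(** In real terms, A sqrt((2K + 1) / (2dK + 1)) < B + 1.  Expanding in K, this is
    A ^ 2 < 2 K m + (B + 1) ^ 2 with m = d (B + 1) ^ 2 - A ^ 2.  The margin is
    thin for d = 2 and d = 3, where (X1, Y1) is known and X_n < K is used exactly;
    for d >= 5 the bounds 2 A <= 3 K and 3 A <= 4 m suffice. *)
Lemma pell_sum_lt n K : ~ (exists s, d = s ^ 2) -> 0 < n -> pell_x n < K ->
  pell_sum_x n ^ 2 * (2 * K).+1 < (pell_sum_y n).+1 ^ 2 * (2 * (d * K)).+1.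
Proof.
move=> nsq n_gt0 lt_K; have e := fund_eq; have Y1_gt0 := fund_gt0; have X1_ge2 := fund_ge2.
have [c [eA ec]] := pell_sum_conic n; have ed := pell_sum_conic_dual ec.
have eX := pell_x_sum n_gt0; have le_A := pell_sum_x_le n_gt0; have B_ge := pell_sum_y_gt0 n_gt0.
have minX x y : 0 < y -> x ^ 2 = d * y ^ 2 + 1 -> X1 <= x.
  by move=> y_gt0 h; case: fund => _ /(_ x y) minX; apply: minX; apply/pell_solutionE.
move: (pell_sum_x n) (pell_sum_y n) (pell_x n) eA ec ed eX le_A B_ge lt_K => A B X eA ec ed eX le_A B_ge lt_K.
(* Here m = d (B + 1) ^ 2 - A ^ 2, simplified by the conic. *)
suff [m mE h] : exists2 m, 2 * d * B + d = m + A + c & A ^ 2 < 2 * K * m + B.+1 ^ 2.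
  have : A ^ 2 + m = d * B.+1 ^ 2 by lia.
  move=> dE; nia.
have [d2|d_n2] := eqVneq d 2.
  have X13 : X1 = 3.
    have := minX 3 2; rewrite d2 => /(_ isT erefl) le3.
    by move: e X1_ge2; rewrite d2; case: X1 le3 => [|[|[|[|x]]]] //; nia.
  have Y12 : Y1 = 2 by move: e; rewrite d2 X13; nia.
  move: ec eA eX B_ge; rewrite d2 X13 Y12 => ec eA eX B_ge.
  have {ec} cE : c = 2 * B by lia.
  rewrite cE in eA *.
  have : 2 * A <= 3 * B + 2 by nia.
  by exists (2 * B + 2 - A); [lia | nia].
have [d3|d_n3] := eqVneq d 3.
  have X12 : X1 = 2 by have := minX 2 1; rewrite d3 => /(_ isT erefl); lia.
  have Y11 : Y1 = 1 by move: e; rewrite d3 X12; nia.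
  move: ec eA eX B_ge; rewrite d3 X12 Y11 => ec eA eX B_ge.
  have {ec} cE : c = 3 * B by lia.
  rewrite cE in eA *.
  have : A <= 2 * B + 1 by nia.
  by exists (3 * B + 3 - A); [lia | nia].
have d_ge5 : 5 <= d.
  by case: d d_ge2 d_n2 d_n3 nsq => [|[|[|[|[|d']]]]] // _ _ _ [] ; exists 2.
have c_sq : c ^ 2 <= 3 * (d * B ^ 2).
  have eq_sq : X1 * c ^ 2 = c ^ 2 + (X1 + 1) * (d * B ^ 2).
    have : c * (X1 * c) = c * (d * Y1 * B + c) by rewrite ed.
    have : d * B * (Y1 * c) = d * B * ((X1 + 1) * B) by rewrite ec.
    lia.
  have [z zE] : exists z, X1 = z + 2 by exists (X1 - 2); lia.
  rewrite -(@leq_pmul2l z.+1) //; have := leq0n (z * (d * B ^ 2)).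
  by move: eq_sq; rewrite zE; lia.
have c_le : 5 * c <= 4 * (d * B).
  rewrite -leq_sqr !expnMn.
  have : 5 * (d * B ^ 2) <= d * (d * B ^ 2) by rewrite leq_mul2r d_ge5 orbT.
  lia.
(* Otherwise 3A (3A - 3) = 9 (c + d B ^ 2) would be too large. *)
have A_le : 3 * A <= 2 * (d * B) + d.
  rewrite leqNgt; apply/negP => gt_A.
  have := leq_mul gt_A (leq_sub2r 3 gt_A).
  have : 5 * (d * B ^ 2) <= d * (d * B ^ 2) by rewrite leq_mul2r d_ge5 orbT.
  have : 5 * d <= d * d by rewrite leq_mul2r d_ge5 orbT.
  have : 5 * (d * B) <= d * (d * B) by rewrite leq_mul2r d_ge5 orbT.
  have -> : 3 * A * (3 * A - 3) = 9 * (A ^ 2 - A) by lia.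
  have [T TE] : exists T, 2 * (d * B) + d = T + 2 by exists (2 * (d * B) + d - 2); lia.
  have TT : (T + 2) * (T + 2) = (2 * (d * B) + d) * (2 * (d * B) + d) by rewrite TE.
  rewrite TE; have -> : (T + 2).+1 - 3 = T by lia.
  lia.
have [m mE] : exists m, 2 * d * B + d = m + A + c by exists (2 * d * B + d - A - c); lia.
exists m => //.
have m_ge : 3 * A <= 4 * m by lia.
have K_ge : 2 * A <= 3 * K by lia.
have := leq_mul K_ge m_ge; have := expn_gt0 B.+1 2; lia.
Qed.

Lemma pell_count K n : pell_x n < K -> K <= pell_x n.+1 ->
  \sum_(x < K) \sum_(y < K) (x ^ 2 == d * y ^ 2 + 1) * x = pell_sum_x n.
Proof.
move=> lt_K ge_K.
have y_lt i : pell_y i < pell_x i by rewrite -ltn_sqr pell_norm; nia.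
have delta (x y : nat) : x < K -> (x ^ 2 == d * y ^ 2 + 1) =
    \sum_(i < n.+1) ((x == pell_x i) && (y == pell_y i)) :> nat.
  move=> lt_x; case: eqP => [sol|nsol]; last first.
    rewrite big1 // => i _; case: andP => // -[/eqP xE /eqP yE].
    by case: nsol; rewrite xE yE pell_norm.
  have [m [xE yE]] := pell_complete sol.
  have lt_m : m < n.+1 by rewrite -pell_x_mono -xE (leq_trans lt_x).
  rewrite (bigD1 (Ordinal lt_m)) //= -xE -yE !eqxx big1 // => i.
  by rewrite -val_eqE /= xE (inj_eq pell_x_inj) eq_sym => /negPf->.
transitivity (\sum_(x < K) \sum_(y < K) \sum_(i < n.+1)
    ((x == pell_x i :> nat) && (y == pell_y i :> nat)) * x).
  by apply: eq_bigr => x _; apply: eq_bigr => y _; rewrite delta // big_distrl.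
under eq_bigr do rewrite exchange_big.
rewrite exchange_big /=; apply: eq_bigr => i _.
have lt_i : pell_x i < K.
  apply: leq_ltn_trans lt_K; rewrite leqNgt pell_x_mono -leqNgt -ltnS //.
have lt_iy := ltn_trans (y_lt i) lt_i.
rewrite (bigD1 (Ordinal lt_i)) //= (bigD1 (Ordinal lt_iy)) //= !eqxx mul1n.
rewrite big1 => [|y]; last by rewrite -val_eqE /= => /negPf->.
rewrite big1 ?addn0 // => x; rewrite -val_eqE /= => /negPf ne.
by rewrite big1 // => y _; rewrite ne.
Qed.

Lemma pell_last K : X1 < K -> exists n, [/\ 0 < n, pell_x n < K & K <= pell_x n.+1].
Proof.
move=> lt_K.
have ex : exists n, K <= pell_x n by exists K; rewrite ltnW // pell_x_ge.
have pell_x1 : pell_x 1 = X1 by rewrite pell_xS /pell_x /pell_y /=; lia.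
case: (ex_minnP ex) => -[|[|n]] le_K minK.
- by move: le_K; rewrite /pell_x /=; have := fund_ge2; lia.
- by move: le_K; rewrite pell_x1; lia.
by exists n.+1; split=> //; rewrite ltnNge; apply/negP => /minK; rewrite ltnn.
Qed.

End Pell.

(** * Power sums as truncated quotients *)

Definition power_sum k b n := \sum_(i < n) i ^ k * b ^ i.

Lemma power_sum0_quotient b n : 2 < b -> b ^ n %/ (b - 1) = power_sum 0 b n.
Proof.
move=> b_gt2; rewrite -(@geometric b n) ?(ltnW (ltnW b_gt2)) // mulnC.
rewrite divnMDl ?subn_gt0 ?(ltnW b_gt2) // divn_small ?addn0; last by lia.
by apply: eq_bigr => i _; rewrite mul1n.
Qed.

(** The derivation formula for geometric sums, with the negative terms moved to
    the other side. *)
Lemma power_sum2_closed u t (b := u.+1) (v := u * t) (Z := b ^ t.+1) :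
  u ^ 3 * power_sum 2 b t.+1 + b * (b + 1) + 2 * v * Z = Z * (v ^ 2 + b + 1).
Proof.
rewrite {}/v {}/Z; elim: t => [|t IHt].
  by rewrite /power_sum big_ord_recl big_ord0 /=; lia.
rewrite /power_sum big_ord_recr /= -/(power_sum 2 b t.+1) (expnS b t.+1).
move: (power_sum _ _ _) (b ^ t.+1) IHt => S Z; rewrite /b; lia.
Qed.

Lemma power_sum4_closed u t (b := u.+1) (v := u * t) (Z := b ^ t.+1) :
  u ^ 5 * power_sum 4 b t.+1 + b * (b + 1) * (b ^ 2 + 10 * b + 1)
    + Z * (4 * v ^ 3 + 4 * v * (b ^ 2 + 4 * b + 1))
  = Z * (v ^ 4 + 6 * (b + 1) * v ^ 2 + (b + 1) * (b ^ 2 + 10 * b + 1)).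
Proof.
rewrite {}/v {}/Z; elim: t => [|t IHt].
  by rewrite /power_sum big_ord_recl big_ord0 /=; lia.
rewrite /power_sum big_ord_recr /= -/(power_sum 4 b t.+1) (expnS b t.+1).
move: (power_sum _ _ _) (b ^ t.+1) IHt => S Z; rewrite /b; lia.
Qed.

(** The correction b (b + 1) in the closed form is smaller than the divisor. *)
Lemma power_sum2_quotient b t (v := (b - 1) * t) : 32 <= b -> 2 <= t ->
  (b ^ t.+1 * (v * (v - 2) + (b + 1))) %/ (b - 1) ^ 3 = power_sum 2 b t.+1.
Proof.
rewrite {}/v; case: b => // u; rewrite subn1 /= => le_u t_ge2.
have := power_sum2_closed u t; set v := u * t; set Z := u.+1 ^ t.+1 => closed.
have v_ge2 : 2 <= v by rewrite /v; nia.
have [w wE] : exists w, v = w + 2 by exists (v - 2); lia.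
have -> : Z * (v * (v - 2) + (u.+1 + 1)) =
  power_sum 2 u.+1 t.+1 * u ^ 3 + u.+1 * (u.+1 + 1).
  by move: closed; rewrite wE addnK; lia.
rewrite divnMDl ?expn_gt0 ?(leq_trans _ le_u) //; last by lia.
rewrite divn_small ?addn0 //.
have := leq_mul (leq_mul (leqnn u) le_u) (leqnn u); nia.
Qed.

(** As for squares, the correction is a polynomial of degree 4 in b, smaller
    than (b - 1) ^ 5.  The inner truncated subtraction is exact because t >= 2. *)
Lemma power_sum4_quotient b t (v := (b - 1) * t) (z := v - 2) (g2 := v * z + (b + 1)) :
  32 <= b -> 2 <= t ->
  (b ^ t.+1 * (g2 * g2 + b * (4 * v * (z - (b + 1)) + (b + 1) * (b + 9)))) %/ (b - 1) ^ 5
  = power_sum 4 b t.+1.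
Proof.
rewrite {}/g2 {}/z {}/v.
case: b => // u; rewrite subn1 /= => le_u t_ge2.
have := power_sum4_closed u t; set v := u * t; set Z := u.+1 ^ t.+1 => closed.
have v_ge : 2 * u <= v by rewrite /v; nia.
have [w wE] : exists w, v = w + (u.+1 + 1) + 2 by exists (v - (u.+1 + 1) - 2); lia.
set X := Z * _; have -> : X = power_sum 4 u.+1 t.+1 * u ^ 5
     + u.+1 * (u.+1 + 1) * (u.+1 ^ 2 + 10 * u.+1 + 1).
  rewrite /X; have -> : v - 2 = w + (u.+1 + 1) by lia.
  by rewrite addnK; move: closed; rewrite wE; lia.
rewrite divnMDl ?expn_gt0; last by lia.
rewrite divn_small ?addn0 //.
have h k : 31 * u ^ k <= u ^ k.+1 by rewrite expnS leq_mul2r; lia.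
have := h 1; have := h 2; have := h 3; have := h 4; rewrite expn1; lia.
Qed.

(** * The packed integer *)

Section Packing.
Variables d K w : nat.
Hypothesis d_gt0 : 0 < d.
Hypothesis K_gt1 : 1 < K.
Hypothesis w_ge : d ^ 2 * K ^ 4 <= 2 ^ w.

Let P := 2 ^ w.
Let q := P * P.
Let q1 := q ^ K.
Let q2 := q1 ^ K.
Let Q := q1 * q2.

(** This is P + 1 - (x ^ 2 - d y ^ 2 - 1) ^ 2, arranged so that the only
    subtraction has a nonnegative result. *)
Definition pell_digit (x y : nat) : nat :=
  P + 2 * x ^ 2 * (1 + d * y ^ 2) - (x ^ 4 + 2 * d * y ^ 2 + d ^ 2 * y ^ 4).

(** The size of P ensures (x ^ 2 - d y ^ 2 - 1) ^ 2 <= P on the whole grid. *)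
Lemma pell_digitP x y : x < K -> y < K ->
  if x ^ 2 == d * y ^ 2 + 1 then pell_digit x y = P + 1 else 0 < pell_digit x y <= P.
Proof.
move=> lt_x lt_y; rewrite /pell_digit.
have lt_x2 : x ^ 2 < K ^ 2 by rewrite ltn_sqr.
have lt_y2 : y ^ 2 < K ^ 2 by rewrite ltn_sqr.
have -> : x ^ 4 = (x ^ 2) ^ 2 by lia.
have -> : d ^ 2 * y ^ 4 = (d * y ^ 2) ^ 2 by lia.
rewrite -(mulnA 2 d); have lt_D : d * y ^ 2 < d * K ^ 2 by rewrite ltn_pmul2l.
have lt_X : x ^ 2 < d * K ^ 2 by apply: leq_trans lt_x2 _; rewrite leq_pmull.
have : (d * K ^ 2) ^ 2 <= P by apply: leq_trans w_ge; lia.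
move: (x ^ 2) (d * y ^ 2) (d * K ^ 2) lt_X lt_D => X D N lt_X lt_D le_P.
case: eqP => [->|ne]; first by lia.
suff [e /andP[e_gt0 le_e] h] : exists2 e, 0 < e <= N &
    X ^ 2 + 2 * D + D ^ 2 + 1 = 2 * X * (1 + D) + e ^ 2.
  have e2_gt0 : 0 < e ^ 2 by rewrite expn_gt0 e_gt0.
  have : e ^ 2 <= N ^ 2 by rewrite leq_sqr.
  lia.
have [lt|le] := ltnP (D + 1) X.
  exists (X - (D + 1)); first by lia.
  by rewrite -(subnK (ltnW lt)); move: (X - (D + 1)) => e; lia.
have lt : X < D + 1 by lia.
exists (D + 1 - X); first by lia.
have [e eE] : exists e, D + 1 = e + X by exists (D + 1 - X); lia.
rewrite eE addnK.
have : D * D + 2 * D + 1 = (e + X) * (e + X) by rewrite -eE; lia.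
have : X * (D + 1) = X * (e + X) by rewrite eE.
lia.
Qed.

Let K_gt0 : 0 < K := ltnW K_gt1.

Let c x y := (P - 1) * pell_digit x y.

Lemma P_gt1 : 1 < P.
Proof.
apply: leq_trans w_ge; apply: (@leq_trans (K ^ 4)).
  by apply: (leq_trans K_gt1); rewrite -[leqLHS]expn1 leq_pexp2l.
by rewrite leq_pmull // expn_gt0 d_gt0.
Qed.

Lemma digit_lt x y : x < K -> y < K -> c x y < q.
Proof.
move=> lt_x lt_y; have := pell_digitP lt_x lt_y; have := P_gt1; rewrite /c /q.
by case: eqP => _ P1; [move=> ->|case/andP => _]; nia.
Qed.

Lemma popcount_digit x y : x < K -> y < K ->
  popcount (c x y) = w * (1 + (x ^ 2 == d * y ^ 2 + 1)).
Proof.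
move=> lt_x lt_y; have := pell_digitP lt_x lt_y; rewrite /c.
case: eqP => _ => [->|le_f]; last by rewrite popcount_mul_ones // muln1.
have -> : (P - 1) * (P + 1) = 2 ^ (w + w) - 1.
  by rewrite expnD -/P; have := P_gt1; nia.
by rewrite popcount_ones; lia.
Qed.

Let row x := \sum_(y < K) c x y * q ^ y.

Lemma row_lt x : x < K -> row x < q1.
Proof. by move=> lt_x; apply: digits_lt => y; apply: digit_lt. Qed.

(** Adding 1 to the lowest digit does not create a carry. *)
Lemma sum_digits_strict b n (f : nat -> nat) : 0 < n -> (forall i, i < n -> f i < b) ->
  (f 0).+1 < b -> (\sum_(i < n) f i * b ^ i).+1 < b ^ n.
Proof.
case: n => // n _ f_lt f0; pose g i := f i + (i == 0).
have -> : (\sum_(i < n.+1) f i * b ^ i).+1 = \sum_(i < n.+1) g i * b ^ i.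
  rewrite !big_ord_recl /g /= addn1 mulSn add1n addSn; congr (_ + _).+1.
  by apply: eq_bigr => i _; rewrite addn0.
apply: digits_lt => -[|i] lt_i; rewrite /g /= ?addn1 ?addn0 //; exact: f_lt.
Qed.

(** The point (0, 0) is not a solution, so the lowest digit is not q - 1 and the
    packed grid is not the all-ones word. *)
Lemma packed_rem_lt : \sum_(x < K) row x * q1 ^ x < q2 - 1.
Proof.
have h : (\sum_(x < K) row x * q1 ^ x).+1 < q2.
  apply: sum_digits_strict => //; first exact: row_lt.
  apply: sum_digits_strict => // [y|]; first exact: digit_lt.
  have := pell_digitP K_gt0 K_gt0; have := P_gt1; rewrite /c /q.
  rewrite exp0n // muln0 /=; nia.
lia.
Qed.

Lemma shifted_row_lt j x : x < K -> (j < x) * row x < q1.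
Proof. by move/row_lt; case: (j < x); rewrite ?mul1n ?mul0n // => /(leq_ltn_trans (leq0n _)). Qed.

Let layer j := \sum_(x < K) ((j < x) * row x) * q1 ^ x.

Lemma layer_lt j : layer j < q2.
Proof. by apply: (@digits_lt q1 K (fun x => (j < x) * row x)) => x; apply: shifted_row_lt. Qed.

(** Layer j keeps the rows of index above j, hence row x occurs in x layers. *)
Definition packed_integer := \sum_(j < K) layer j * q2 ^ j.

Lemma q2_gt0 : 0 < q2.
Proof. by rewrite !expn_gt0 muln_gt0 (ltnW P_gt1). Qed.

(** As Q ^ x = q1 ^ x * q2 ^ x, each row contributes a geometric sum in q2 to the
    quotient and leaves its copy of weight q1 ^ x in the remainder. *)
Lemma packed_quotient : (\sum_(x < K) row x * Q ^ x) %/ (q2 - 1) = packed_integer.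
Proof.
have -> : \sum_(x < K) row x * Q ^ x =
   packed_integer * (q2 - 1) + \sum_(x < K) row x * q1 ^ x.
  rewrite /packed_integer /layer; under [X in X * _]eq_bigr do rewrite big_distrl.
  rewrite exchange_big big_distrl -big_split /=; apply: eq_bigr => x _.
  have -> : Q ^ x = q1 ^ x * q2 ^ x by rewrite expnMn.
  rewrite -(geometric x q2_gt0) mulnA mulnDr muln1; congr (_ + _).
  have -> : \sum_(j < x) q2 ^ j = \sum_(j < K) (j < x) * q2 ^ j.
    rewrite (big_ord_widen K (fun j => q2 ^ j) (ltnW (ltn_ord x))) big_mkcond.
    by apply: eq_bigr => j _; case: ifP; rewrite ?mul1n ?mul0n.
  rewrite mulnA mulnAC; congr (_ * _); rewrite big_distrr /=.
  by apply: eq_bigr => j _; lia.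
have lt := packed_rem_lt.
by rewrite divnMDl ?(leq_ltn_trans _ lt) // divn_small ?addn0.
Qed.

Let q_pow : q = 2 ^ (2 * w). Proof. by rewrite /q -expnD; congr (2 ^ _); lia. Qed.
Let q1_pow : q1 = 2 ^ (2 * w * K). Proof. by rewrite /q1 q_pow -expnM. Qed.
Let q2_pow : q2 = 2 ^ (2 * w * K * K). Proof. by rewrite /q2 q1_pow -expnM. Qed.

Lemma packed_lt : packed_integer < 2 ^ (2 * w * K ^ 3).
Proof.
have -> : 2 ^ (2 * w * K ^ 3) = q2 ^ K by rewrite q2_pow -expnM; congr (2 ^ _); lia.
by apply: digits_lt => j _; apply: layer_lt.
Qed.

Lemma popcount_packed : popcount packed_integer =
  w * (\sum_(x < K) \sum_(y < K) x + \sum_(x < K) \sum_(y < K) (x ^ 2 == d * y ^ 2 + 1) * x).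
Proof.
rewrite /packed_integer q2_pow.
rewrite (@popcount_digits _ _ layer) => [|j _]; last by rewrite -q2_pow layer_lt.
transitivity (\sum_(j < K) \sum_(x < K) (j < x) * popcount (row x)).
  apply: eq_bigr => j _; rewrite /layer q1_pow (@popcount_digits _ _ (fun x => (j < x) * row x)).
    by apply: eq_bigr => x _; case: (j < x); rewrite ?mul1n ?mul0n ?popcount0.
  by move=> x; rewrite -q1_pow; apply: shifted_row_lt.
rewrite exchange_big -big_split big_distrr /=; apply: eq_bigr => x _.
have -> : popcount (row x) = \sum_(y < K) w * (1 + (x ^ 2 == d * y ^ 2 + 1)).
  rewrite /row q_pow (@popcount_digits _ _ (c x)).
    by apply: eq_bigr => y _; apply: popcount_digit.
  by move=> y; rewrite -q_pow; apply: digit_lt.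
have row_count : \sum_(j < K) (j < x) = x.
  rewrite -[RHS]card_ord -sum1_card (big_ord_widen K (fun=> 1) (ltnW (ltn_ord x))).
  by rewrite [RHS]big_mkcond; apply: eq_bigr => j _; case: ifP.
rewrite -big_distrl /= row_count big_distrr -big_split big_distrr /=.
by apply: eq_bigr => y _; lia.
Qed.

Lemma pack_identity (U := fun k => power_sum k Q K) (V := fun k => power_sum k q K) :
  (P - 1) * ((V 0 * (P * U 0 - U 4) + 2 * U 2 * (V 0 + d * V 2))
      - U 0 * (2 * (d * V 2) + d * d * V 4)) = \sum_(x < K) row x * Q ^ x.
Proof.
pose T a b := \sum_(x < K) \sum_(y < K) x ^ a * y ^ b * (Q ^ x * q ^ y).
pose S := \sum_(x < K) \sum_(y < K) pell_digit x y * (Q ^ x * q ^ y).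
have UV a b : U a * V b = T a b.
  rewrite /U /V /power_sum big_distrlr; apply: eq_bigr => x _.
  by apply: eq_bigr => y _; rewrite mulnACA.
have -> : \sum_(x < K) row x * Q ^ x = (P - 1) * S.
  rewrite /S big_distrr; apply: eq_bigr => x _; rewrite /row big_distrl big_distrr.
  by apply: eq_bigr => y _; rewrite /c /=; lia.
congr (_ * _).
have le_U : U 4 <= P * U 0.
  rewrite /U /power_sum big_distrr; apply: leq_sum => x _ /=; rewrite mul1n leq_mul2r.
  apply/orP; right; apply: leq_trans w_ge; apply: (@leq_trans (K ^ 4)).
    by rewrite leq_exp2r // ltnW.
  by rewrite leq_pmull // expn_gt0 d_gt0.
have key : P * T 0 0 + 2 * T 2 0 + 2 * d * T 2 2 = S + T 4 0 + 2 * d * T 0 2 + d ^ 2 * T 0 4.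
  rewrite /S /T !big_distrr -!big_split; apply: eq_bigr => x _ /=.
  rewrite !big_distrr -!big_split; apply: eq_bigr => y _ /=.
  have : x ^ 4 + 2 * d * y ^ 2 + d ^ 2 * y ^ 4 <= P + 2 * x ^ 2 * (1 + d * y ^ 2).
    have := pell_digitP (ltn_ord x) (ltn_ord y); rewrite /pell_digit.
    by case: eqP; lia.
  move/subnK; rewrite -/(pell_digit x y) => e.
  transitivity ((pell_digit x y + (x ^ 4 + 2 * d * y ^ 2 + d ^ 2 * y ^ 4)) * (Q ^ x * q ^ y)).
    by rewrite e; lia.
  lia.
have [u uE] : exists u, P * U 0 = u + U 4 by exists (P * U 0 - U 4); lia.
rewrite uE addnK; move: key; rewrite -!UV => key.
have h : V 0 * (P * U 0) = V 0 * (u + U 4) by rewrite uE.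
suff -> : V 0 * u + 2 * U 2 * (V 0 + d * V 2) = S + U 0 * (2 * (d * V 2) + d * d * V 4).
  by rewrite addnK.
lia.
Qed.

End Packing.

(** * Evaluation with a size bound *)

Section Runs.
Variable W : nat.
Hypothesis W_gt0 : 0 < W.

(** A common bound on the factors a of all the sizes 2 ^ (a * W) met below. *)
Definition trace_size := 100.

(** Positivity of the factor makes the bounds add up under addition as well as
    under multiplication, so that one rule computes both. *)
Definition small a n := (0 < a) && (n <= 2 ^ (a * W)).

Definition runs A (m : Defs.comp A) (r : A) :=
  result m = Some r /\ forall n, n \in trace m -> n <= 2 ^ (trace_size * W).

Definition evals (e : expr) n a := runs e n /\ small a n.

Lemma small_pow2 a k : 0 < a -> k <= a * W -> small a (2 ^ k).
Proof. by rewrite /small => -> /= h; rewrite leq_exp2l. Qed.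

Lemma small_le a m n : m <= n -> small a n -> small a m.
Proof. by move=> le_mn /andP[a_gt0 le_n]; rewrite /small a_gt0 (leq_trans le_mn). Qed.

Lemma small_mul a b m n : small a m -> small b n -> small (a + b) (m * n).
Proof.
move=> /andP[a_gt0 le_m] /andP[b_gt0 le_n].
by rewrite /small addn_gt0 a_gt0 /= mulnDl expnD leq_mul.
Qed.

Lemma small_add a b m n : small a m -> small b n -> small (a + b) (m + n).
Proof.
move=> /andP[a_gt0 le_m] /andP[b_gt0 le_n].
rewrite /small addn_gt0 a_gt0 /= mulnDl expnD; apply: leq_trans (leq_add le_m le_n) _.
have pow_ge2 k : 0 < k -> 2 <= 2 ^ (k * W).
  by move=> k_gt0; rewrite -[leqLHS]expn1 leq_exp2l // muln_gt0 k_gt0.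
have := pow_ge2 _ a_gt0; have := pow_ge2 _ b_gt0; nia.
Qed.

Lemma small_expn a k m : 0 < k -> small a m -> small (a * k) (m ^ k).
Proof.
move=> k_gt0 /andP[a_gt0 le_m].
by rewrite /small muln_gt0 a_gt0 k_gt0 mulnAC expnM leq_exp2r.
Qed.

Lemma small_num n : n <= 16 -> small 4 n.
Proof.
move=> le_n; rewrite /small /=; apply: leq_trans le_n _.
by rewrite -[16]/(2 ^ 4) leq_exp2l // leq_pmulr.
Qed.

Lemma runs_ret A (r : A) : runs (ret r) r.
Proof. by split. Qed.

Lemma runs_bind A B (m : Defs.comp A) (k : A -> Defs.comp B) a r :
  runs m a -> runs (k a) r -> runs (bind m k) r.
Proof.
rewrite /runs /bind => -[-> m_tr] /= [-> k_tr]; split=> // n.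
by rewrite mem_cat => /orP[/m_tr|/k_tr].
Qed.

Lemma runs_emit n a : small a n -> a <= trace_size -> runs (emit (Some n)) n.
Proof.
move=> /andP[_ le_n] le_a; split=> // m; rewrite inE => /eqP->.
by rewrite (leq_trans le_n) // leq_exp2l // leq_mul2r le_a orbT.
Qed.

Lemma evals_op f e1 e2 m n p a b c : evals e1 m a -> evals e2 n b ->
  f m n = Some p -> small c p -> c <= trace_size -> evals (binop f e1 e2) p c.
Proof.
move=> [run1 _] [run2 _] f_eq small_p le_c; split=> //.
apply: runs_bind run1 _; apply: runs_bind run2 _.
by rewrite f_eq; apply: runs_emit small_p le_c.
Qed.

Lemma evals_add e1 e2 m n a b : evals e1 m a -> evals e2 n b ->
  a + b <= trace_size -> evals (e_add e1 e2) (m + n) (a + b).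
Proof. by move=> ev1 ev2; apply: (evals_op ev1 ev2) => //; exact: small_add ev1.2 ev2.2. Qed.

Lemma evals_mul e1 e2 m n a b : evals e1 m a -> evals e2 n b ->
  a + b <= trace_size -> evals (e_mul e1 e2) (m * n) (a + b).
Proof. by move=> ev1 ev2; apply: (evals_op ev1 ev2) => //; exact: small_mul ev1.2 ev2.2. Qed.

Lemma evals_sub e1 e2 m n a b : evals e1 m a -> evals e2 n b ->
  a <= trace_size -> evals (e_sub e1 e2) (m - n) a.
Proof.
by move=> ev1 ev2; apply: (evals_op ev1 ev2) => //; exact: small_le (leq_subr _ _) ev1.2.
Qed.

Lemma evals_div e1 e2 m n a b : evals e1 m a -> evals e2 n b ->
  a <= trace_size -> 0 < n -> evals (e_div e1 e2) (m %/ n) a.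
Proof.
move=> ev1 ev2 le_a n_gt0; apply: (evals_op ev1 ev2 _ _ le_a); first by rewrite gtn_eqF.
exact: small_le (leq_div _ _) ev1.2.
Qed.

Lemma evals_mod e1 e2 m n a b : evals e1 m a -> evals e2 n b ->
  a <= trace_size -> 0 < n -> evals (e_mod e1 e2) (m %% n) a.
Proof.
move=> ev1 ev2 le_a n_gt0; apply: (evals_op ev1 ev2 _ _ le_a); first by rewrite gtn_eqF.
exact: small_le (leq_mod _ _) ev1.2.
Qed.

Lemma evals_exp e1 e2 m n a b c : evals e1 m a -> evals e2 n b ->
  c <= trace_size -> small c (m ^ n) -> evals (e_exp e1 e2) (m ^ n) c.
Proof. by move=> ev1 ev2 le_c sm; exact: (evals_op ev1 ev2 _ sm le_c). Qed.

Lemma evals_exp_num e1 m k a : evals e1 m a -> 0 < k <= 16 ->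
  a * k <= trace_size -> evals (e_exp e1 k) (m ^ k) (a * k).
Proof.
move=> ev1 /andP[k_gt0 le_k] le_a.
apply: (evals_exp ev1 (conj (runs_ret k) (small_num le_k)) le_a).
exact: small_expn ev1.2.
Qed.

Lemma evals_val n a : small a n -> evals n n a.
Proof. by move=> sm; split=> //; apply: runs_ret. Qed.

Lemma runs_let A e (k : nat -> Defs.comp A) n n' a r : evals e n a -> n = n' ->
  (small a n' -> runs (k n') r) -> runs (bind e k) r.
Proof. by move=> [run_e sm] <- run_k; apply: runs_bind run_e (run_k sm). Qed.

Lemma runs_evals e n n' a : evals e n a -> n = n' -> runs e n'.
Proof. by move=> [run_e _] <-. Qed.

End Runs.

(** Evaluates an expression by structural recursion; the size factor is an
    existential variable filled bottom-up. *)
Ltac evaluate :=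
  lazymatch goal with
  | |- evals _ (e_add _ _) _ _ => eapply evals_add; [eassumption | evaluate | evaluate | done]
  | |- evals _ (e_mul _ _) _ _ => eapply evals_mul; [evaluate | evaluate | done]
  | |- evals _ (e_sub _ _) _ _ => eapply evals_sub; [evaluate | evaluate | done]
  | |- evals _ (e_div _ _) _ _ => eapply evals_div; [evaluate | evaluate | done | first [assumption | done]]
  | |- evals _ (e_mod _ _) _ _ => eapply evals_mod; [evaluate | evaluate | done | first [assumption | done]]
  | |- evals _ (e_exp _ (expr_of_nat _)) _ _ =>
      first [ eapply evals_exp; [evaluate | evaluate | | eassumption]; [done]
            | eapply evals_exp_num; [eassumption | evaluate | done | done] ]
  | |- evals _ (e_exp _ _) _ _ =>
      eapply evals_exp; [evaluate | evaluate | | eassumption]; [done]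
  | |- evals _ (expr_of_nat _) _ _ =>
      apply: evals_val; first [eassumption | apply: small_num => //]
  end.

Ltac compute_let := eapply runs_let; [evaluate | reflexivity | move=> ?].

Section G024.
Variable W : nat.
Hypothesis W_gt0 : 0 < W.

Lemma runs_G024 b t Z :
  32 <= b -> 2 <= t -> small W 4 b -> small W 4 (b ^ t.+1) -> small W 4 t -> small W 4 t.+1 ->
  Z = None \/ Z = Some (b ^ t.+1) ->
  runs W (G024 b t.+1 t Z) (power_sum 0 b t.+1, power_sum 2 b t.+1, power_sum 4 b t.+1).
Proof.
move=> b_ge t_ge sb sbK st sK ZE.
have u_gt0 : 0 < b - 1 by lia.
have u3_gt0 : 0 < (b - 1) ^ 3 by rewrite expn_gt0 u_gt0.
have u5_gt0 : 0 < (b - 1) ^ 5 by rewrite expn_gt0 u_gt0.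
rewrite /G024.
compute_let.
apply: (@runs_bind _ _ _ _ _ (b ^ t.+1)).
  by case: ZE => ->; [apply: (proj1 (_ : evals W _ _ 4)); evaluate | apply: runs_ret].
compute_let. compute_let. compute_let.
eapply runs_let; [evaluate | apply: power_sum0_quotient; lia | move=> ?].
compute_let. compute_let.
eapply runs_let; [evaluate | exact: power_sum2_quotient | move=> ?].
compute_let. compute_let. compute_let.
eapply runs_let; [evaluate | exact: power_sum4_quotient | move=> ?].
exact: runs_ret.
Qed.
End G024.

(** * From the sum of the abscissae to the fundamental solution *)

(** With D = 2 ^ (2dK - 2K) * C(2K, K), whose square carries the factor 16 ^
    (dK - K), both bounds on the quotient are compared after squaring. *)
Lemma central_bin_ratio_quotient d K A B : 0 < d -> 0 < K -> d * B ^ 2 <= A ^ 2 ->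
  A ^ 2 * (2 * K).+1 < B.+1 ^ 2 * (2 * (d * K)).+1 ->
  (A * central_bin (d * K)) %/ (2 ^ (d * (2 * K) - 2 * K) * central_bin K) = B.
Proof.
move=> d_gt0 K_gt0 le_B lt_A.
have le_K : K <= d * K by rewrite leq_pmull.
have := central_bin_ge le_K; have := central_bin_le le_K.
have -> : 16 ^ (d * K - K) = (2 ^ (d * (2 * K) - 2 * K)) ^ 2.
  by rewrite -[16]/(2 ^ 4) -!expnM; congr (2 ^ _); lia.
set e := 2 ^ _; have e_gt0 : 0 < e by rewrite expn_gt0.
have b_gt0 := central_bin_gt0 K; move: (central_bin K) (central_bin (d * K)) b_gt0 => b b' b_gt0.
rewrite -!(mulnA _ (b ^ 2)) -expnMn [b * e]mulnC => up lo.
have D_gt0 : 0 < e * b by rewrite muln_gt0 e_gt0.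
move: (e * b) D_gt0 up lo => D D_gt0 up lo.
have {}lo : D ^ 2 <= d * b' ^ 2 by rewrite -(leq_pmul2l K_gt0); lia.
apply/eqP; rewrite eqn_leq -ltnS ltn_divLR // leq_divRL //; apply/andP; split.
  rewrite -ltn_sqr !expnMn -(@ltn_pmul2r (2 * (d * K)).+1) //.
  apply: (@leq_ltn_trans (A ^ 2 * ((2 * K).+1 * D ^ 2))).
    by rewrite -mulnA leq_mul2l [b' ^ 2 * _]mulnC up orbT.
  by rewrite mulnA [ltnRHS]mulnAC ltn_pmul2r // expn_gt0 D_gt0.
rewrite -leq_sqr !expnMn; apply: (@leq_trans (B ^ 2 * (d * b' ^ 2))).
  by rewrite leq_mul2l lo orbT.
by rewrite mulnA leq_mul2r [B ^ 2 * d]mulnC le_B orbT.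
Qed.

Lemma runs_ratio_C W d K A B p : 0 < W -> 0 < d -> 0 < K -> 4 ^ (d * K) <= p ->
  small W 1 d -> small W 1 K -> small W 2 A -> small W 2 p -> small W 2 (p ^ K) ->
  small W 6 ((p + 1) ^ (2 * K)) -> small W 6 ((p + 1) ^ (d * (2 * K))) ->
  small W 2 ((p ^ K) ^ d) -> small W 2 (2 ^ (d * (2 * K) - 2 * K)) ->
  d * B ^ 2 <= A ^ 2 -> A ^ 2 * (2 * K).+1 < B.+1 ^ 2 * (2 * (d * K)).+1 ->
  runs W (ratio_C d K A p (p ^ K)) B.
Proof.
move=> W_gt0 d_gt0 K_gt0 le_p sd sK sA sp sv szh szH svd s2 le_B lt_A.
have p_gt0 : 0 < p by apply: leq_trans le_p; rewrite expn_gt0.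
have v_gt0 : 0 < p ^ K by rewrite expn_gt0 p_gt0.
have vd_gt0 : 0 < (p ^ K) ^ d by rewrite expn_gt0 v_gt0.
have dK_gt0 : 0 < d * K by rewrite muln_gt0 d_gt0.
have le_p' : 4 ^ K <= p by apply: leq_trans le_p; rewrite leq_exp2l // leq_pmull.
have ac_gt0 : 0 < 2 ^ (d * (2 * K) - 2 * K) * central_bin K by rewrite muln_gt0 expn_gt0 central_bin_gt0.
rewrite /ratio_C.
compute_let. compute_let.
eapply runs_let; [evaluate | exact: central_bin_extract | move=> ?].
compute_let.
eapply runs_let; [evaluate | | move=> ?].
  by rewrite -expnM [K * d]mulnC mulnCA central_bin_extract.
compute_let.
by eapply runs_evals; [evaluate | exact: central_bin_ratio_quotient].
Qed.

Lemma runs_recover_R W d X1 Y1 n A B : 0 < W -> 2 <= d -> fundamental_solution d X1 Y1 ->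
  0 < n -> A = pell_sum_x d X1 Y1 n -> B = pell_sum_y d X1 Y1 n ->
  small W 1 d -> small W 2 A -> small W 2 B -> runs W (recover_R d A B) (X1, Y1).
Proof.
move=> W_gt0 d_ge2 fund n_gt0 AE BE sd sA sB.
have [Dc_gt0 X_eq Y_eq] := recover_R_value d_ge2 fund n_gt0 AE BE (erefl _).
rewrite /recover_R.
compute_let. compute_let. compute_let. compute_let.
eapply runs_let; [evaluate | exact: X_eq | move=> ?].
eapply runs_let; [evaluate | exact: Y_eq | move=> ?].
exact: runs_ret.
Qed.

(** * The whole program *)

Lemma sum_grid_abscissae K : \sum_(x < K) \sum_(y < K) x = K * K * (K - 1) %/ 2.
Proof.
under eq_bigr do rewrite sum_nat_const card_ord.
rewrite -big_distrr /= -(big_mkord xpredT (fun x => x)) bin2_sum bin2 subn1 -divn2 -mulnA.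
by rewrite muln_divA // dvdn2 oddM; case: K => //= k; rewrite andNb.
Qed.

Section Sizes.
Variables d K w W : nat.
Hypothesis d_ge2 : 2 <= d.
Hypothesis d_le : d <= w.
Hypothesis K_ge3 : 3 <= K.
Hypothesis W_ge1 : w * K ^ 3 <= W.
Hypothesis W_ge2 : w * d * K ^ 2 <= W.

Let d_gt0 : 0 < d := ltnW d_ge2.
Let w_gt0 : 0 < w := leq_trans d_gt0 d_le.
Let K_gt0 : 0 < K := ltnW (ltnW K_ge3).

Lemma wK2_le : w * K ^ 2 <= W.
Proof. by apply: leq_trans W_ge1; rewrite leq_mul2l leq_pexp2l ?orbT. Qed.

Lemma wdK_le : w * d * K <= W.
Proof. by apply: leq_trans W_ge2; rewrite leq_mul2l -[leqLHS]expn1 leq_pexp2l ?orbT. Qed.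

Lemma wK_le : w * K <= W.
Proof. by apply: leq_trans wK2_le; rewrite leq_mul2l -[leqLHS]expn1 leq_pexp2l ?orbT. Qed.

Lemma wd_le : w * d <= W. Proof. by apply: leq_trans wdK_le; rewrite leq_pmulr. Qed.

Lemma w_le : w <= W. Proof. by apply: leq_trans wd_le; rewrite leq_pmulr. Qed.

Lemma W_gt0 : 0 < W. Proof. exact: leq_trans w_gt0 w_le. Qed.

Lemma small_self k : k <= W -> small W 1 k.
Proof.
move=> le_k; apply: (@small_le _ _ _ (2 ^ k)); first by rewrite ltnW // ltn_expl.
by apply: small_pow2; rewrite ?mul1n.
Qed.

Lemma small_d : small W 1 d. Proof. exact: small_self (leq_trans d_le w_le). Qed.

Lemma small_K : small W 1 K.
Proof. by apply/small_self/(leq_trans _ wK_le); rewrite leq_pmull. Qed.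

Lemma small_w : small W 1 w. Proof. exact: small_self w_le. Qed.

Lemma small_P : small W 1 (2 ^ w). Proof. by apply: small_pow2; rewrite ?mul1n ?w_le. Qed.

Lemma packing_base : 2 ^ w * 2 ^ w = 2 ^ (2 * w).
Proof. by rewrite -expnD mul2n addnn. Qed.

Lemma small_q1 : small W 2 ((2 ^ w * 2 ^ w) ^ K).
Proof. by rewrite packing_base -expnM; apply: small_pow2 => //; rewrite -mulnA leq_mul2l wK_le. Qed.

Lemma small_q2 : small W 2 (((2 ^ w * 2 ^ w) ^ K) ^ K).
Proof.
rewrite packing_base -!expnM; apply: small_pow2 => //.
by rewrite -!mulnA leq_mul2l wK2_le.
Qed.

Lemma small_QK : small W 4 (((2 ^ w * 2 ^ w) ^ K * ((2 ^ w * 2 ^ w) ^ K) ^ K) ^ K).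
Proof.
rewrite packing_base -!expnM -expnD -expnM; apply: small_pow2 => //.
have -> : (2 * w * K + 2 * w * K * K) * K = 2 * (w * K ^ 2) + 2 * (w * K ^ 3) by lia.
have := wK2_le; lia.
Qed.

Lemma central_base_ge : 4 ^ (d * K) <= (2 ^ w * 2 ^ w) ^ K.
Proof.
by rewrite packing_base -[4]/(2 ^ 2) -!expnM leq_exp2l // mulnA leq_mul2r leq_mul2l d_le !orbT.
Qed.

Lemma small_shifted_pow m : 0 < m -> w * K * m <= 2 * W ->
  small W 6 (((2 ^ w * 2 ^ w) ^ K + 1) ^ m).
Proof.
move=> m_gt0 le_m; apply: (@small_le _ _ _ (2 ^ (3 * (w * K) * m))); last first.
  by apply: small_pow2 => //; rewrite -mulnA; move: le_m; move: (_ * m) => x; lia.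
rewrite expnM leq_exp2r // packing_base -expnM.
apply: (@leq_trans (2 ^ (2 * w * K).+1)).
  by rewrite [leqRHS]expnS [leqRHS]mul2n -(addnn (2 ^ _)) leq_add2l expn_gt0.
by rewrite leq_exp2l // -mulnA; move: (muln_gt0 w K); rewrite w_gt0 K_gt0; lia.
Qed.

Lemma small_shifted_pow_K : small W 6 (((2 ^ w * 2 ^ w) ^ K + 1) ^ (2 * K)).
Proof.
apply: small_shifted_pow; first by rewrite muln_gt0.
by rewrite mulnCA leq_mul2l -mulnA wK2_le.
Qed.

Lemma small_shifted_pow_dK : small W 6 (((2 ^ w * 2 ^ w) ^ K + 1) ^ (d * (2 * K))).
Proof.
apply: small_shifted_pow; first by rewrite !muln_gt0 d_gt0.
have -> : w * K * (d * (2 * K)) = 2 * (w * d * K ^ 2) by lia.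
by rewrite leq_mul2l W_ge2.
Qed.

Lemma small_vd : small W 2 ((((2 ^ w * 2 ^ w) ^ K) ^ K) ^ d).
Proof.
rewrite packing_base -!expnM; apply: small_pow2 => //.
rewrite -!mulnA; have -> : w * (K * (K * d)) = w * d * K ^ 2 by lia.
by rewrite leq_mul2l W_ge2.
Qed.

Lemma small_scale : small W 2 (2 ^ (d * (2 * K) - 2 * K)).
Proof.
apply: small_pow2 => //; apply: leq_trans (leq_subr _ _) _.
rewrite mulnCA leq_mul2l /=; apply: leq_trans wdK_le.
by rewrite -mulnA leq_pmull.
Qed.

Lemma power_sum_le k b n : 1 < b -> power_sum k b n <= n ^ k * b ^ n.
Proof.
move=> b_gt1; have b_gt0 := ltnW b_gt1.
apply: (@leq_trans (n ^ k * \sum_(i < n) b ^ i)).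
  rewrite big_distrr; apply: leq_sum => i _ /=; rewrite leq_mul2r; apply/orP; right.
  by case: k => // k; rewrite leq_exp2r // ltnW.
rewrite leq_mul2l -(geometric n b_gt0) (leq_trans _ (leq_addr _ _)) ?orbT //.
by rewrite leq_pmull // subn_gt0.
Qed.

Lemma small_power_sum k b : 1 < b -> small W 4 (b ^ K) -> k <= 4 -> small W 8 (power_sum k b K).
Proof.
move=> b_gt1 sbK le_k; apply: small_le (power_sum_le _ _ b_gt1) _.
apply: (@small_mul _ 4 4) sbK; apply: small_le (@small_expn _ 1 4 _ isT small_K).
exact: leq_pexp2l.
Qed.

(** Each exact quotient is replaced by its mathematical value as soon as it is
    computed, so that the next step sees a closed form. *)
Lemma runs_QO X1 Y1 :
  ~ (exists s, d = s ^ 2) -> fundamental_solution d X1 Y1 -> X1 < K ->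
  d ^ 2 * K ^ 4 <= 2 ^ w ->
  exists2 M, runs W (QO d K w) (M, (X1, Y1)) & M < 2 ^ (2 * w * K ^ 3).
Proof.
move=> nonsquare fund X1_lt w_ge.
have K_gt1 : 1 < K := ltnW K_ge3.
have sd := small_d; have sK := small_K; have sw := small_w; have sP := small_P.
have sq1 := small_q1; have sq2 := small_q2; have sQK := small_QK.
have szh := small_shifted_pow_K; have szH := small_shifted_pow_dK.
have svd := small_vd; have s2 := small_scale; have Wpos := W_gt0.
have le_q1 := central_base_ge.
have [n [n_gt0 lt_n ge_n]] := pell_last d_ge2 fund X1_lt.
have count := pell_count d_ge2 fund lt_n ge_n.
set A := pell_sum_x d X1 Y1 n in count.
set B := pell_sum_y d X1 Y1 n.
have le_B : d * B ^ 2 <= A ^ 2 by apply: pell_sum_ge.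
have lt_A : A ^ 2 * (2 * K).+1 < B.+1 ^ 2 * (2 * (d * K)).+1 by apply: pell_sum_lt.
have popM := popcount_packed d_gt0 K_gt1 w_ge; rewrite {}count sum_grid_abscissae in popM.
have M_lt := packed_lt d_gt0 K_gt1 w_ge.
have quotM := packed_quotient d_gt0 K_gt1 w_ge.
rewrite -(pack_identity d_gt0 K_gt1 w_ge) in quotM.
exists (packed_integer d K w) => //.
move: (packed_integer d K w) popM M_lt quotM => M popM M_lt quotM.
have A_gt0 : 0 < A by rewrite /A /pell_sum_x big_ord_recl.
have M_gt0 : 0 < M.
  rewrite lt0n; apply/eqP => M0; move: popM; rewrite M0 popcount0 => /esym/eqP.
  by rewrite muln_eq0 addn_eq0 (gtn_eqF A_gt0) (gtn_eqF w_gt0) andbF.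
have sM : small W 2 M.
  apply: small_le (ltnW M_lt) _; apply: small_pow2 => //.
  by rewrite -mulnA leq_mul2l W_ge1.
have sHM : small W 2 (popcount M) by apply: small_le (popcount_le M) sM.
have A_eq : popcount M %/ w - K * K * (K - 1) %/ 2 = A by rewrite popM mulKn // addKn.
have sA : small W 2 A by rewrite -A_eq; apply: small_le sHM; apply: leq_trans (leq_subr _ _) (leq_div _ _).
have sB : small W 2 B.
  apply: small_le sA; rewrite -leq_sqr; apply: leq_trans le_B; exact: leq_pmull.
have P_ge : 9 <= 2 ^ w.
  apply: leq_trans w_ge; apply: (@leq_trans (1 * 3 ^ 4)) => //.
  by rewrite leq_mul ?expn_gt0 ?d_gt0 // leq_exp2r.
have q_ge : 32 <= 2 ^ w * 2 ^ w by apply: leq_trans (leq_mul P_ge P_ge).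
have sq : small W 2 (2 ^ w * 2 ^ w) by apply: (@small_mul _ 1 1).
have q1_gt0 : 0 < (2 ^ w * 2 ^ w) ^ K by rewrite expn_gt0 muln_gt0 expn_gt0.
have q_le : 2 ^ w * 2 ^ w <= (2 ^ w * 2 ^ w) ^ K.
  by rewrite -[leqLHS]expn1 leq_pexp2l // (leq_trans _ q_ge).
have q2_gt1 : 0 < ((2 ^ w * 2 ^ w) ^ K) ^ K - 1.
  rewrite subn_gt0 (leq_trans _ (leq_trans q_ge (leq_trans q_le _))) //.
  by rewrite -[leqLHS]expn1 leq_pexp2l.
have Q_ge : 32 <= (2 ^ w * 2 ^ w) ^ K * ((2 ^ w * 2 ^ w) ^ K) ^ K.
  by apply: leq_trans (leq_trans q_ge q_le) _; rewrite leq_pmulr // expn_gt0 q1_gt0.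
have KE : (K - 1).+1 = K by rewrite subn1 prednK.
have t_ge : 2 <= K - 1 by rewrite leq_subRL.
have st : small W 1 (K - 1) by apply: small_le sK; exact: leq_subr.
have weaken a b m : a <= b -> small W a m -> small W b m.
  move=> le_ab /andP[a_gt0 le_m]; rewrite /small (leq_trans a_gt0 le_ab) /=.
  by apply: leq_trans le_m _; rewrite leq_exp2l // leq_mul2r le_ab orbT.
have runs_G b Z : 32 <= b -> small W 4 b -> small W 4 (b ^ K) -> Z = None \/ Z = Some (b ^ K) ->
    runs W (G024 b K (K - 1) Z) (power_sum 0 b K, power_sum 2 b K, power_sum 4 b K).
  move=> b_ge sb sbK; have := @runs_G024 W Wpos b (K - 1) Z b_ge t_ge sb.
  by rewrite KE; apply => //; [apply: weaken st | apply: weaken sK].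
rewrite /QO.
compute_let. compute_let. compute_let. compute_let.
compute_let. compute_let. compute_let.
apply: runs_bind; first by apply: runs_G => //; left.
apply: runs_bind.
  by apply: runs_G => //; [apply: weaken sq | apply: weaken sq1 | right].
have sU k := @small_power_sum k _ (leq_trans (isT : 1 < 32) Q_ge) sQK.
have sV k := @small_power_sum k _ (leq_trans (isT : 1 < 32) q_ge) (weaken 2 4 _ isT sq1).
move/(_ 0 isT): (sU) => sU0; move/(_ 2 isT): (sU) => sU2; move/(_ 4 isT): (sU) => sU4.
move/(_ 0 isT): (sV) => sV0; move/(_ 2 isT): (sV) => sV2; move/(_ 4 isT): (sV) => sV4.
compute_let. compute_let. compute_let.
eapply runs_let; [evaluate | exact: quotM | move=> _].
apply: (@runs_bind _ _ _ _ _ (popcount M)).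
  by rewrite /untraced result_hamming //; apply: runs_emit sHM _.
compute_let.
eapply runs_let; [evaluate | exact: A_eq | move=> _].
apply: runs_bind; first by apply: (@runs_ratio_C _ _ _ A B).
apply: runs_bind; first by apply: (runs_recover_R Wpos d_ge2 fund n_gt0).
exact: runs_ret.
Qed.

End Sizes.

Lemma binary_digits_le n k : n <= 2 ^ k -> binary_digits n <= k.+1.
Proof.
rewrite /binary_digits ltnS; case: n => [|n le_n]; first by rewrite trunc_log0.
by rewrite -(@leq_exp2l 2) // (leq_trans (trunc_logP _ _)).
Qed.

Lemma binary_digits_lt n k : 0 < k -> n < 2 ^ k -> binary_digits n <= k.
Proof.
rewrite /binary_digits; case: n => [|n] k_gt0 lt_n; first by rewrite trunc_log0.
by rewrite -(@ltn_exp2l 2) // (leq_ltn_trans (trunc_logP _ _)).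
Qed.

Theorem theorem13 :
  exists C1 C2 : nat,
  forall d K w X1 Y1 : nat,
    2 <= d ->
    ~ (exists s : nat, d = s ^ 2) ->
    fundamental_solution d X1 Y1 ->
    X1 < K ->
    d <= w ->
    d ^ 2 * K ^ 4 <= 2 ^ w ->
    exists M : nat,
      [/\ result (QO d K w) = Some (M, (X1, Y1)),
          binary_digits M <= 2 * w * K ^ 3,
          forall n : nat, n \in trace (QO d K w) ->
            binary_digits n <= C1 * (w * K ^ 3 + w * d * K ^ 2)
        & d <= K ->
          forall n : nat, n \in trace (QO d K w) ->
            binary_digits n <= C2 * (w * K ^ 3)].
Proof.
(* A number at most 2 ^ k may have k + 1 binary digits, hence the successor; for
   d <= K the two terms of the bound are comparable, hence the factor 2. *)
exists trace_size.+1, (2 * trace_size.+1) => d K w X1 Y1 d_ge2 nonsquare fund X1_lt d_le w_ge.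
set W := w * K ^ 3 + w * d * K ^ 2.
have K_ge3 : 3 <= K by apply: leq_ltn_trans X1_lt; apply: fund_ge2 fund.
have w_gt0 : 0 < w by rewrite (leq_trans _ d_le) // ltnW.
have wK3_gt0 : 0 < w * K ^ 3 by rewrite muln_gt0 w_gt0 expn_gt0 (leq_trans _ K_ge3).
have W_ge1 : w * K ^ 3 <= W := leq_addr _ _.
have W_ge2 : w * d * K ^ 2 <= W := leq_addl _ _.
have [M [res_eq trace_le] M_lt] := runs_QO d_ge2 d_le K_ge3 W_ge1 W_ge2 nonsquare fund X1_lt w_ge.
have digits_le n : n \in trace (QO d K w) -> binary_digits n <= trace_size.+1 * W.
  move/trace_le/binary_digits_le => /leq_trans; apply.
  by rewrite mulSn addnC -addn1 leq_add2l (leq_trans wK3_gt0).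
exists M; split=> //.
  by apply: binary_digits_lt M_lt; rewrite -mulnA muln_gt0.
move=> le_dK n /digits_le/leq_trans; apply.
rewrite [2 * _]mulnC -mulnA leq_mul2l /= mul2n -addnn leq_add2l -mulnA leq_mul2l.
by rewrite (expnS K 2) leq_mul2r le_dK !orbT.
Qed.
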